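(* Consider the mixed boundary condition scenario ($|\Gamma_{uN}|>0$, $|\Gamma_{uD}|>0$). There are numbers $a_2,b_2,c_2,d_2$ with $$a_2=\tfrac12\Big(\sqrt{4(1+C_{\text{Korn}})+1}+1\Big)+\mathcal O(\epsilon),\qquad d_2=\tfrac12\Big(\sqrt{4(1+C_{\text{Korn}})+1}+1\Big)+\mathcal O(\epsilon),$$ $$b_2=\tfrac12\Big(\sqrt{4\tfrac{\beta^2}{1+\beta^2}+1}-1\Big)+\mathcal O(\epsilon),\qquad c_2=\tfrac12\Big(\sqrt{4\tfrac{\beta^2}{1+\beta^2}+1}-1\Big)+\mathcal O(\epsilon),$$ such that the residuals $\mathbf r_j$ of MINRES applied to the preconditioned system associated with the coefficient matrix $\tilde{\mathcal P}_{d,N}^{-1}\tilde{\mathcal A}_{3,N}$ satisfy, for all $k\ge0$, $$\frac{\|\mathbf r_{2k}\|}{\|\mathbf r_0\|}\le 2\left(\frac{\sqrt{\frac{a_2d_2}{b_2c_2}}-1}{\sqrt{\frac{a_2d_2}{b_2c_2}}+1}\right)^k.$$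
   Context: Setting. $\Omega\subset\mathbb R^d$ is a bounded connected Lipschitz domain with a quasi-uniform simplicial mesh $\mathcal T_h$ with $N$ elements $K_1,\dots,K_N$, $h$ the maximal element diameter; the mesh is connected (any two elements are joined by a chain of elements sharing interior facets). $\partial\Omega=\Gamma_{uD}\cup\Gamma_{uN}=\Gamma_{pD}\cup\Gamma_{pN}$ are non-overlapping partitions into unions of boundary facets. Fixed positive constants: $\mu,\alpha,c_0,\kappa,\Delta t$. $\lambda>0$ is the locking parameter and $\epsilon=2\mu/\lambda$. Spaces. For a simplex $K$ with vertices $\mathbf x_0,\dots,\mathbf x_d$, barycentric coordinates $\lambda_j$, facet $e_i$ opposite $\mathbf x_i$ with unit outward normal $\mathbf n_i$, let $BR_1(K)=(P_1(K))^d+\mathrm{span}\{\mathbf n_i\prod_{\mathbf x_j\in e_i}\lambda_j:\ i=0,\dots,d\}$ (Bernardi-Raugel space). $\mathbf V_h^0$ is the space of $\mathbf v_h\in (H^1(\Omega))^d$ with $\mathbf v_h|_K\in BR_1(K)$ for all $K$ and $\mathbf v_h=0$ on $\Gamma_{uD}$. $W_h^0$ is the space of pairs $p_h=\{p_h^\circ,p_h^\partial\}$ with $p_h^\circ$ constant on each element, $p_h^\partial$ constant on each facet, $p_h^\partial=0$ on facets in $\Gamma_{pD}$. $\mathcal P_0$ is the space of elementwise constants. The weak gradient $\nabla_w p_h$ is elementwise in $RT_0(K)=(P_0(K))^d+\mathbf x P_0(K)$, defined by $(\nabla_w p_h,\mathbf w)_K=(p_h^\partial,\mathbf w\cdot\mathbf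 n)_{\partial K}-(p_h^\circ,\nabla\cdot\mathbf w)_K$ for all $\mathbf w\in RT_0(K)$. Functions are identified with their coefficient vectors (elementwise constants with their vectors of values in $\mathbb R^N$). Matrices. $\mathbf v_h^TA_1\mathbf u_h=\sum_K(\varepsilon(\mathbf u_h),\varepsilon(\mathbf v_h))_K$ with $\varepsilon(\mathbf u)=\frac12(\nabla\mathbf u+\nabla\mathbf u^T)$ (symmetric positive definite on $\mathbf V_h^0$); $\mathbf q_h^TB^\circ\mathbf u_h=\sum_K(\nabla\cdot\mathbf u_h,q_h)_K$ for $q_h\in\mathcal P_0$; $M_p^\circ=\mathrm{diag}(|K_1|,\dots,|K_N|)$; $A_0=(B^\circ)^T(M_p^\circ)^{-1}B^\circ$; $A_p$ is defined by $\mathbf q_h^TA_p\mathbf p_h=\sum_K(\nabla_wp_h,\nabla_wq_h)_K$ on $W_h^0$, partitioned into interior ($\circ$) and facet ($\partial$) blocks $A_p=\begin{bmatrix} A_p^{\circ\circ} & A_p^{\circ\partial} \\ A_p^{\partial\circ} & A_p^{\partial\partial} \end{bmatrix}$; $\tilde D=c_0M_p^\circ+\kappa\Delta t\,(A_p^{\circ\circ}-A_p^{\circ\partial}(A_p^{\partial\partial})^{-1}A_p^{\partial\circ})$. $$\tilde{\mathcal A}_{3,N}=\begin{bmatrix} A_1 & 0 & -(B^\circ)^T \\ 0 & -\frac{2\mu}{\alpha^2}\tilde D-\epsilon M_p^\circ & -\epsilon M_p^\circ \\ -B^\circ & -\epsilon M_p^\circ & -\epsilon M_p^\circ \end{bmatrix},\qquad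 \tilde{\mathcal P}_{d,N}=\mathrm{diag}\Big(A_1,\ \tfrac{2\mu}{\alpha^2}\tilde D+\epsilon M_p^\circ,\ M_p^\circ\Big).$$ Constants. $\beta\in(0,1)$ is an inf-sup constant independent of $h$: $\sup_{0\ne\mathbf v_h\in\mathbf V_h^0}\frac{\mathbf p_h^TB^\circ\mathbf v_h}{(\mathbf v_h^TA_1\mathbf v_h)^{1/2}}\ge\beta(\mathbf p_h^TM_p^\circ\mathbf p_h)^{1/2}$ for all $p_h\in\mathcal P_0$. $C_{\text{Korn}}$ is a constant, independent of $h$, from Korn's inequality, with $\mathbf u_h^TA_0\mathbf u_h\le C_{\text{Korn}}\,\mathbf u_h^TA_1\mathbf u_h$ for all $\mathbf u_h\in\mathbf V_h^0$. $\mathcal O(\epsilon)$ is understood as $\epsilon\to0$ (i.e. $\lambda\to\infty$), with constants independent of $\epsilon$ and $h$. MINRES. Preconditioned MINRES for $\tilde{\mathcal A}_{3,N}$ with the symmetric positive definite preconditioner $\tilde{\mathcal P}_{d,N}$ is MINRES applied to a system with symmetric matrix $\tilde{\mathcal P}_{d,N}^{-1/2}\tilde{\mathcal A}_{3,N}\tilde{\mathcal P}_{d,N}^{-1/2}$ (similar to $\tilde{\mathcal P}_{d,N}^{-1}\tilde{\mathcal A}_{3,N}$), for an arbitrary right-hand side and initial guess; $\mathbf r_j$ is the residual of this preconditioned system after $j$ iterations (with $\mathbf r_0\neq0$) and $\|\cdot\|$ is the Euclidean norm. *)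

(* Defs.v *)
From HB Require Import structures.
From mathcomp Require Export all_boot all_order all_algebra.
From mathcomp Require Export all_classical all_reals all_analysis.
Export Order.TTheory GRing.Theory Num.Theory.
Export numFieldNormedType.Exports.

Set Implicit Arguments.
Unset Strict Implicit.
Unset Printing Implicit Defensive.

Local Open Scope classical_set_scope.
Local Open Scope ring_scope.

(* The library norm of matrices is the sup norm; this is the Euclidean one. *)
Definition enorm (R : realType) (m n : nat) (A : 'M[R]_(m, n)) : R :=
  Num.sqrt (\sum_i \sum_j A i j ^+ 2).

Definition dotv (R : realType) (n : nat) (u v : 'rV[R]_n) : R :=
  \sum_i u 0 i * v 0 i.

Definition qform (R : realType) (n : nat) (A : 'M[R]_n) (u : 'cV[R]_n) : R :=
  (u^T *m A *m u) 0 0.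

Definition spd (R : realType) (n : nat) (A : 'M[R]_n) : Prop :=
  A^T = A /\ forall u : 'cV[R]_n, u != 0 -> 0 < qform A u.

Definition tuple_cons (R : realType) (n : nat) (z : measurableTypeR R * n.-tuple R) :
  n.+1.-tuple R := [tuple of z.1 :: z.2].

Lemma measurable_tuple_cons (R : realType) (n : nat) :
  measurable_fun setT (@tuple_cons R n).
Proof. by apply: measurable_cons. Qed.

Definition tuple_cons_measure (R : realType) (n : nat)
    (nu : {sigma_finite_measure set (n.-tuple R) -> \bar R}) :
    set (n.+1.-tuple R) -> \bar R :=
  pushforward (lebesgue_measure \x nu)%E (@tuple_cons R n).

Section TupleConsMeasure.
Variables (R : realType) (n : nat).
Variable nu : {sigma_finite_measure set (n.-tuple R) -> \bar R}.
Let mu := tuple_cons_measure nu.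
Let prod := [the {measure set _ -> \bar R} of
  (@lebesgue_measure R \x nu)%E].

Let mcons (A : set (n.+1.-tuple R)) :
  measurable A -> measurable (@tuple_cons R n @^-1` A).
Proof.
by move=> mA; rewrite -[X in measurable X]setTI; exact: measurable_tuple_cons.
Qed.

Let mu0 : mu set0 = 0%E.
Proof. by rewrite /mu /tuple_cons_measure /pushforward preimage_set0 measure0. Qed.

Let mu_ge0 A : (0 <= mu A)%E.
Proof. exact: measure_ge0 prod _. Qed.

Let mu_sigma_additive : semi_sigma_additive mu.
Proof.
move=> F mF tF mUF; rewrite /mu /tuple_cons_measure /pushforward preimage_bigcup.
apply: (@measure_semi_sigma_additive _ _ _ prod).
- by move=> k; exact: mcons.
- apply/trivIsetP => /= i j _ _ ij; rewrite -preimage_setI.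
  by move/trivIsetP : tF => /(_ _ _ _ _ ij) ->//; rewrite preimage_set0.
- by rewrite -preimage_bigcup; exact: mcons.
Qed.

HB.instance Definition _ := isMeasure.Build _ _ _
  (tuple_cons_measure nu) mu0 mu_ge0 mu_sigma_additive.

Let uncons (t : n.+1.-tuple R) : measurableTypeR R * n.-tuple R := (thead t, [tuple of behead t]).

Let muncons (A : set (measurableTypeR R * n.-tuple R)) :
  measurable A -> measurable (uncons @^-1` A).
Proof.
move=> mA; rewrite -[X in measurable X]setTI.
suff mu' : measurable_fun setT uncons by exact: mu'.
apply/measurable_fun_pairP; split => /=.
  exact: (measurable_tnth ord0).
exact: measurable_behead.
Qed.

Let mu_sigma_finite : sigma_finite setT (tuple_cons_measure nu).
Proof.
have /sigma_finiteP[F [TF ndF Foo]] := sigma_finiteT (@lebesgue_measure R).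
have /sigma_finiteP[G [TG ndG Goo]] := sigma_finiteT nu.
exists (fun k => uncons @^-1` (F k `*` G k)).
  rewrite -preimage_bigcup; apply/seteqP; split => // t _.
  have [i _ Fi] : (\bigcup_i F i) (uncons t).1 by rewrite -TF.
  have [j _ Gj] : (\bigcup_i G i) (uncons t).2 by rewrite -TG.
  exists (maxn i j) => //; split.
  - by move: Fi; exact/subsetPset/ndF/leq_maxl.
  - by move: Gj; exact/subsetPset/ndG/leq_maxr.
move=> k; have [mF Fk] := Foo k; have [mG Gk] := Goo k.
split; first by apply: muncons; exact: measurableX.
rewrite /tuple_cons_measure /pushforward.
have consK (z : measurableTypeR R * n.-tuple R) : uncons (tuple_cons z) = z.
  by case: z => x t; congr pair; exact/val_inj.
have -> : @tuple_cons R n @^-1` (uncons @^-1` (F k `*` G k)) = F k `*` G k.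
  by apply/funext => z; exact: (congr1 (F k `*` G k) (consK z)).
by rewrite product_measure1E// lte_mul_pinfty// ge0_fin_numE.
Qed.

HB.instance Definition _ := Measure_isSigmaFinite.Build _ _ _
  (tuple_cons_measure nu) mu_sigma_finite.

End TupleConsMeasure.

(* The n-fold product of the Lebesgue measure of R, on n-tuples since these
   carry the product sigma-algebra in the library. *)
Fixpoint lebesgue_tuple (R : realType) (n : nat) :
    {sigma_finite_measure set (n.-tuple R) -> \bar R} :=
  match n with
  | 0 => \d_([tuple] : 0.-tuple R)
  | m.+1 => tuple_cons_measure (lebesgue_tuple R m)
  end.

Definition row_of (R : realType) (n : nat) (t : n.-tuple R) : 'rV[R]_n :=
  \row_i tnth t i.

Definition integral_on (R : realType) (n : nat) (D : set 'rV[R]_n)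
    (f : 'rV[R]_n -> R) : R :=
  \int[lebesgue_tuple R n]_(t in [set t | D (row_of t)]) f (row_of t).

Section Sobolev.
Variables (R : realType) (n : nat).
Implicit Types (Omega : set 'rV[R]_n) (f phi : 'rV[R]_n -> R).

Definition partial f (i : 'I_n) : 'rV[R]_n -> R := 'D_(delta_mx 0 i) f.

Definition square_integrable Omega f : Prop :=
  measurable_fun [set t | Omega (row_of t)] (f \o @row_of R n) /\
  (\int[lebesgue_tuple R n]_(t in [set t | Omega (row_of t)])
      (f (row_of t) ^+ 2)%:E < +oo)%E.

Fixpoint class_C (k : nat) phi : Prop :=
  continuous phi /\
  match k with
  | 0 => True
  | k'.+1 => forall i : 'I_n,
      (forall x, derivable phi x (delta_mx 0 i)) /\ class_C k' (partial phi i)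
  end.

Definition test_function Omega phi : Prop :=
  (forall k, class_C k phi) /\
  exists C : set 'rV[R]_n,
    [/\ compact C, C `<=` Omega & forall x, ~ C x -> phi x = 0].

Definition weak_partial Omega f (i : 'I_n) (g : 'rV[R]_n -> R) : Prop :=
  forall phi, test_function Omega phi ->
    integral_on Omega (fun x => f x * partial phi i x) =
    - integral_on Omega (fun x => g x * phi x).

Definition sobolev_H1 Omega f : Prop :=
  square_integrable Omega f /\
  forall i : 'I_n, exists g, square_integrable Omega g /\ weak_partial Omega f i g.

End Sobolev.

Definition frontier (R : realType) (n : nat) (Omega : set 'rV[R]_n) :
  set 'rV[R]_n := closure Omega `\` interior Omega.

(* Near each boundary point, in suitable orthonormal coordinates, Omega is the
   strict epigraph of a Lipschitz function of the last n coordinates. *)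
Definition lipschitz_domain (R : realType) (n : nat) (Omega : set 'rV[R]_n.+1) :
    Prop :=
  [/\ Omega !=set0, open Omega, bounded_set Omega, connected Omega &
    forall x0, frontier Omega x0 ->
      exists (Q : 'M[R]_n.+1) (r : R) (gam : 'rV[R]_n -> R),
        [/\ Q *m Q^T = 1%:M, 0 < r, lipschitz gam &
          forall x, enorm (x - x0) < r ->
            let y : 'rV[R]_(1 + n) := (x - x0) *m Q in
            Omega x <-> gam (rsubmx y) < lsubmx y 0 0]].

Record mesh (R : realType) (n : nat) := Mesh {
  n_vert : nat;
  n_elem : nat;
  point : 'I_n_vert -> 'rV[R]_n.+1;
  cell : 'I_n_elem -> 'I_n.+2 -> 'I_n_vert
}.

Section Mesh.
Variables (R : realType) (n : nat) (T : mesh R n).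
Implicit Types (K : 'I_(n_elem T)) (F : {set 'I_(n_vert T)}).

Definition hull F : set 'rV[R]_n.+1 :=
  [set x | exists c : 'I_(n_vert T) -> R,
    [/\ forall v, 0 <= c v, \sum_(v in F) c v = 1 &
        x = \sum_(v in F) c v *: point v]].

Definition cell_set K : {set 'I_(n_vert T)} := [set cell K j | j : 'I_n.+2].

(* The facet opposite to the i-th vertex. *)
Definition facet K (i : 'I_n.+2) : {set 'I_(n_vert T)} :=
  [set cell K j | j : 'I_n.+2 & j != i].

Definition facets : {set {set 'I_(n_vert T)}} :=
  [set facet z.1 z.2 | z : 'I_(n_elem T) * 'I_n.+2].

Definition boundary_facets : {set {set 'I_(n_vert T)}} :=
  [set F in facets | #|[set K | [exists i, facet K i == F]]| == 1%N].

Definition adjacent : rel 'I_(n_elem T) :=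
  fun K K' => (K != K') && [exists i, exists i', facet K i == facet K' i'].

(* Row j is (1, x_j): the barycentric coordinates l of x are determined by
   l *m vertex_mx K = (1, x). *)
Definition vertex_mx K : 'M[R]_(1 + n.+1) :=
  \matrix_(j < 1 + n.+1) (row_mx (1%:M : 'rV[R]_1) (point (cell K j))).

Definition bary K (j : 'I_n.+2) (x : 'rV[R]_n.+1) : R :=
  (row_mx (1%:M : 'rV[R]_1) x *m invmx (vertex_mx K)) 0 j.

Definition grad_bary K (j : 'I_n.+2) : 'rV[R]_n.+1 :=
  \row_k invmx (vertex_mx K) (rshift 1 k) j.

(* bary K i vanishes on the i-th facet and is positive inside K. *)
Definition normal K (i : 'I_n.+2) : 'rV[R]_n.+1 :=
  - (enorm (grad_bary K i))^-1 *: grad_bary K i.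

Definition diameter K : R :=
  sup [set enorm (z.1 - z.2) | z in
        [set z | hull (cell_set K) z.1 /\ hull (cell_set K) z.2]].

Definition inradius K : R :=
  sup [set r | exists c, forall x, enorm (x - c) <= r -> hull (cell_set K) x].

Definition mesh_size : R := \big[Num.max/0]_K diameter K.

Definition quasi_uniform (s : R) : Prop :=
  forall K, mesh_size <= s * inradius K.

Definition simplicial_mesh (Omega : set 'rV[R]_n.+1) : Prop :=
  [/\ (0 < n_elem T)%N,
      forall K, vertex_mx K \in unitmx,
      injective cell_set,
      forall K K', hull (cell_set K) `&` hull (cell_set K') =
                   hull (cell_set K :&: cell_set K') &
      closure Omega = \bigcup_(K in setT) hull (cell_set K)].

Definition connected_mesh : Prop := forall K K', connect adjacent K K'.

Definition boundary_partition (Omega G1 G2 : set 'rV[R]_n.+1) : Prop :=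
  frontier Omega = G1 `|` G2 /\
  exists D : {set {set 'I_(n_vert T)}},
    [/\ D \subset boundary_facets,
        G1 = \bigcup_(F in [set` D]) hull F &
        G2 = \bigcup_(F in [set` boundary_facets :\: D]) hull F].

(* Elements are integrated over their interiors: the boundary is a null set, and
   elementwise smooth functions need not have derivatives there. *)
Definition elem_int K (f : 'rV[R]_n.+1 -> R) : R :=
  integral_on [set x | forall j, 0 < bary K j x] f.

Definition volume K : R := elem_int K (cst 1).

(* Surface integral over the i-th facet, with vertices y_0, ..., y_n, through its
   parametrization over the unit simplex of R^n. *)
Definition facet_int K (i : 'I_n.+2) (f : 'rV[R]_n.+1 -> R) : R :=
  let y (j : 'I_n.+1) := point (cell K (lift i j)) in
  let E : 'M[R]_(n, n.+1) := \matrix_(k < n) (y (lift ord0 k) - y ord0) in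
  Num.sqrt (\det (E *m E^T)) *
  integral_on [set t : 'rV[R]_n | (forall k, 0 <= t 0 k) /\ \sum_k t 0 k <= 1]
              (fun t => f (y ord0 + t *m E)).

(* Surface measure of a union G of boundary facets. *)
Definition surface_measure (G : set 'rV[R]_n.+1) : R :=
  \sum_K \sum_(i | (facet K i \in boundary_facets) &&
                   `[< hull (facet K i) `<=` G >]) facet_int K i (cst 1).

Definition divergence (v : 'rV[R]_n.+1 -> 'rV[R]_n.+1) (x : 'rV[R]_n.+1) : R :=
  \tr ('J v x).

Definition strain (v : 'rV[R]_n.+1 -> 'rV[R]_n.+1) (x : 'rV[R]_n.+1) :
  'M[R]_n.+1 := 2^-1 *: ('J v x + ('J v x)^T).

Definition bernardi_raugel K (v : 'rV[R]_n.+1 -> 'rV[R]_n.+1) : Prop :=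
  exists (a : 'rV[R]_n.+1) (M : 'M[R]_n.+1) (c : 'I_n.+2 -> R),
    forall x, hull (cell_set K) x ->
      v x = a + x *m M +
            \sum_i (c i * \prod_(j | j != i) bary K j x) *: normal K i.

(* These H^1 functions have representatives that are continuous up to the
   boundary; the set consists of those, extended by 0 outside the closure of
   Omega, so that elements are equal as soon as they agree almost everywhere. *)
Definition Vh0 (Omega GuD : set 'rV[R]_n.+1) :
    set ('rV[R]_n.+1 -> 'rV[R]_n.+1) :=
  [set v : 'rV[R]_n.+1 -> 'rV[R]_n.+1 | [/\ forall i : 'I_n.+1, sobolev_H1 Omega (fun x => v x 0 i),
               forall K, bernardi_raugel K v,
               forall x, GuD x -> v x = 0 &
               forall x, ~ closure Omega x -> v x = 0]].

Definition basis_of_space (V : set ('rV[R]_n.+1 -> 'rV[R]_n.+1)) (m : nat)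
    (phi : 'I_m -> 'rV[R]_n.+1 -> 'rV[R]_n.+1) : Prop :=
  (forall i, V (phi i)) /\
  forall v, V v ->
    exists! c : 'cV[R]_m, v = fun x => \sum_i c i 0 *: phi i x.

(* Interior and facet values of a weak Galerkin function. *)
Definition wfun : Type :=
  (('I_(n_elem T) -> R) * ({set 'I_(n_vert T)} -> R))%type.

Definition RT0 : set ('rV[R]_n.+1 -> 'rV[R]_n.+1) :=
  [set w | exists (a : 'rV[R]_n.+1) (b : R), w = fun x => a + b *: x].

Definition is_weak_gradient (p : wfun) K (g : 'rV[R]_n.+1 -> 'rV[R]_n.+1) :
    Prop :=
  RT0 g /\ forall w, RT0 w ->
    elem_int K (fun x => dotv (g x) (w x)) =
    \sum_i facet_int K i (fun x => p.2 (facet K i) * dotv (w x) (normal K i))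
    - elem_int K (fun x => p.1 K * divergence w x).

Definition weak_gradient (p : wfun) K : 'rV[R]_n.+1 -> 'rV[R]_n.+1 :=
  xget (cst 0) [set g | is_weak_gradient p K g].

(* The facets on which weak Galerkin functions are not required to vanish. *)
Definition free_facets (GpD : set 'rV[R]_n.+1) : {set {set 'I_(n_vert T)}} :=
  [set F in facets | ~~ `[< hull F `<=` GpD >]].

Definition wbasis (GpD : set 'rV[R]_n.+1)
    (k : 'I_(n_elem T + #|free_facets GpD|)) : wfun :=
  match fintype.split k with
  | inl K => (fun K' => (K' == K)%:R, fun _ => 0)
  | inr f => (fun _ => 0, fun F => (F == enum_val f)%:R)
  end.

Definition mx_A1 (m : nat) (phi : 'I_m -> 'rV[R]_n.+1 -> 'rV[R]_n.+1) :
    'M[R]_m :=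
  \matrix_(i, j) \sum_K elem_int K
    (fun x => \tr (strain (phi j) x *m (strain (phi i) x)^T)).

Definition mx_B (m : nat) (phi : 'I_m -> 'rV[R]_n.+1 -> 'rV[R]_n.+1) :
    'M[R]_(n_elem T, m) :=
  \matrix_(K, j) elem_int K (divergence (phi j)).

Definition mx_Mp : 'M[R]_(n_elem T) := diag_mx (\row_K volume K).

Definition mx_A0 (m : nat) (phi : 'I_m -> 'rV[R]_n.+1 -> 'rV[R]_n.+1) :
    'M[R]_m :=
  (mx_B phi)^T *m invmx mx_Mp *m mx_B phi.

Definition mx_Ap (GpD : set 'rV[R]_n.+1) :
    'M[R]_(n_elem T + #|free_facets GpD|) :=
  \matrix_(k, l) \sum_K elem_int K
    (fun x => dotv (weak_gradient (wbasis l) K x) (weak_gradient (wbasis k) K x)).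

Definition mx_Dt (GpD : set 'rV[R]_n.+1) (c0 kappa dt : R) :
    'M[R]_(n_elem T) :=
  let A := mx_Ap GpD in
  c0 *: mx_Mp + (kappa * dt) *:
    (ulsubmx A - ursubmx A *m invmx (drsubmx A) *m dlsubmx A).

Section Saddle.
Variables (GpD : set 'rV[R]_n.+1) (mu alpha c0 kappa dt eps : R).
Variables (m : nat) (phi : 'I_m -> 'rV[R]_n.+1 -> 'rV[R]_n.+1).

Definition mx_A3 : 'M[R]_(m + (n_elem T + n_elem T)) :=
  block_mx
    (mx_A1 phi)                 (row_mx 0 (- (mx_B phi)^T))
    (col_mx 0 (- mx_B phi))
    (block_mx
       (- ((2 * mu / alpha ^+ 2) *: mx_Dt GpD c0 kappa dt) - eps *: mx_Mp)
       (- (eps *: mx_Mp))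
       (- (eps *: mx_Mp))
       (- (eps *: mx_Mp))).

Definition mx_Pd : 'M[R]_(m + (n_elem T + n_elem T)) :=
  block_mx
    (mx_A1 phi) 0
    0 (block_mx
         ((2 * mu / alpha ^+ 2) *: mx_Dt GpD c0 kappa dt + eps *: mx_Mp) 0
         0 mx_Mp).

End Saddle.

Definition inf_sup (beta : R) (m : nat)
    (phi : 'I_m -> 'rV[R]_n.+1 -> 'rV[R]_n.+1) : Prop :=
  forall p : 'cV[R]_(n_elem T),
    ((beta * Num.sqrt (qform mx_Mp p))%:E <=
     ereal_sup [set ((p^T *m mx_B phi *m v) 0 0 /
                     Num.sqrt (qform (mx_A1 phi) v))%:E
               | v in [set v : 'cV[R]_m | v != 0%R]])%E.

Definition korn_bound (CKorn : R) (m : nat)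
    (phi : 'I_m -> 'rV[R]_n.+1 -> 'rV[R]_n.+1) : Prop :=
  forall u : 'cV[R]_m, qform (mx_A0 phi) u <= CKorn * qform (mx_A1 phi) u.

End Mesh.

(* S is the inverse square root of P; this forces P to be positive definite. *)
Definition inv_sqrt_mx (R : realType) (m : nat) (P S : 'M[R]_m) : Prop :=
  spd S /\ S *m S *m P = 1%:M.

Definition krylov (R : realType) (m : nat) (A : 'M[R]_m) (r : 'cV[R]_m)
    (j : nat) : set 'cV[R]_m :=
  [set z | exists c : 'I_j -> R, z = \sum_(i < j) c i *: iter i (mulmx A) r].

Definition minres_iterate (R : realType) (m : nat) (A : 'M[R]_m)
    (b x0 : 'cV[R]_m) (j : nat) (x : 'cV[R]_m) : Prop :=
  let Kj := krylov A (b - A *m x0) j in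
  Kj (x - x0) /\
  forall y, Kj (y - x0) -> enorm (b - A *m x) <= enorm (b - A *m y).

(* Main.v *)
(* The preconditioned matrix is symmetric, so its residual after 2k MINRES steps
   is bounded by a Chebyshev polynomial of degree k in its square as soon as
   b |v| <= |A v| <= a |v|, where a2 = d2 = a and b2 = c2 = b.

   Writing G = M^(-1/2) B A1^(-1/2), the preconditioned matrix for eps = 0 is
   [I, 0, -G^T; 0, -I, 0; -G, 0, 0], where beta^2 <= G G^T <= CKorn. The moduli t
   of its eigenvalues lie between the positive roots s of s(1+s) = beta^2 and d of
   d(d-1) = CKorn, strictly inside the claimed limits [b_lim, a_lim]. For eps > 0
   the perturbation has norm O(sqrt eps), because D~ is positive semidefinite;
   hence a = a_lim and b = b_lim are admissible for all small eps, uniformly in the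
   mesh. For the remaining eps the matrix is still nonsingular, which gives some a
   and b.

   That D~ is positive semidefinite follows from A_p being a sum of Gram matrices
   and A_p^(dd) being invertible: testing the weak gradient with the Raviart-Thomas
   field x - x_i isolates the value on the facet opposite to x_i. *)
Require Import Defs.
From mathcomp Require Import measurable_realfun ring lra.
Local Open Scope classical_set_scope.
Local Open Scope ring_scope.

Set Implicit Arguments.
Unset Strict Implicit.
Unset Printing Implicit Defensive.

(** * Quadratic forms *)

Section BilinearForms.
Variable R : realType.

Definition bform (m n : nat) (A : 'M[R]_(m, n)) (u : 'cV[R]_m) (v : 'cV[R]_n) : R :=
  (u^T *m A *m v) 0 0.

Lemma qformE (n : nat) (A : 'M[R]_n) u : qform A u = bform A u u.
Proof. by []. Qed.

Lemma bformDl m n (A : 'M[R]_(m, n)) u1 u2 v :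
  bform A (u1 + u2) v = bform A u1 v + bform A u2 v.
Proof. by rewrite /bform linearD /= !mulmxDl mxE. Qed.

Lemma bformDr m n (A : 'M[R]_(m, n)) u v1 v2 :
  bform A u (v1 + v2) = bform A u v1 + bform A u v2.
Proof. by rewrite /bform mulmxDr mxE. Qed.

Lemma bformZl m n (A : 'M[R]_(m, n)) a u v :
  bform A (a *: u) v = a * bform A u v.
Proof. by rewrite /bform linearZ /= -!scalemxAl mxE. Qed.

Lemma bformZr m n (A : 'M[R]_(m, n)) a u v :
  bform A u (a *: v) = a * bform A u v.
Proof. by rewrite /bform -!scalemxAr mxE. Qed.

Lemma bformNl m n (A : 'M[R]_(m, n)) u v : bform A (- u) v = - bform A u v.
Proof. by rewrite -scaleN1r bformZl mulN1r. Qed.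

Lemma bformNr m n (A : 'M[R]_(m, n)) u v : bform A u (- v) = - bform A u v.
Proof. by rewrite -scaleN1r bformZr mulN1r. Qed.

Definition bformE := (bformDl, bformDr, bformNl, bformNr, bformZl, bformZr).

Lemma bform_addm m n (A B : 'M[R]_(m, n)) u v :
  bform (A + B) u v = bform A u v + bform B u v.
Proof. by rewrite /bform mulmxDr mulmxDl mxE. Qed.

Lemma bform_scalem m n a (A : 'M[R]_(m, n)) u v :
  bform (a *: A) u v = a * bform A u v.
Proof. by rewrite /bform -scalemxAr -scalemxAl mxE. Qed.

Lemma bform_trmx m n (A : 'M[R]_(m, n)) u v : bform A^T u v = bform A v u.
Proof.
rewrite /bform -[in RHS](trmxK (v^T *m A *m u)) [in RHS]mxE.
by rewrite !trmx_mul trmxK mulmxA.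
Qed.

Lemma bform_mulr m n p (A : 'M[R]_(m, n)) (B : 'M[R]_(n, p)) u v :
  bform A u (B *m v) = bform (A *m B) u v.
Proof. by rewrite /bform !mulmxA. Qed.

Lemma bform_mull m n p (A : 'M[R]_(m, n)) (B : 'M[R]_(m, p)) u v :
  bform A (B *m u) v = bform (B^T *m A) u v.
Proof. by rewrite /bform trmx_mul !mulmxA. Qed.

(** Symmetry is left out, so that products and Schur complements qualify without a separate symmetry
    proof. *)
Definition psd (n : nat) (A : 'M[R]_n) : Prop := forall u, 0 <= qform A u.

Lemma qform0 n (A : 'M[R]_n) : qform A 0 = 0.
Proof. by rewrite /qform mulmx0 mxE. Qed.

Lemma spd_psd n (A : 'M[R]_n) : spd A -> psd A.
Proof.
by move=> [_ A0] u; have [->|/A0/ltW//] := eqVneq u 0; rewrite qform0.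
Qed.

Lemma spd_unitmx n (A : 'M[R]_n) : spd A -> A \in unitmx.
Proof.
move=> [As A0]; rewrite -row_free_unit -kermx_eq0; apply/eqP/row_matrixP => i.
rewrite row0; apply/eqP/negPn/negP => k0.
have := A0 (row i (kermx A))^T; rewrite trmx_eq0 => /(_ k0).
rewrite /qform trmxK -row_mul mulmx_ker row0 mul0mx mxE ltxx; exact.
Qed.

Lemma qform1 n (v : 'cV[R]_n) : qform 1%:M v = \sum_i v i 0 ^+ 2.
Proof.
by rewrite /qform mulmx1 mxE; apply: eq_bigr => i _; rewrite mxE expr2.
Qed.

Lemma enormE n (v : 'cV[R]_n) : enorm v = Num.sqrt (qform 1%:M v).
Proof.
by rewrite /enorm qform1; congr Num.sqrt; apply: eq_bigr => i _; rewrite big_ord1.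
Qed.

Lemma spd_1 n : spd (1%:M : 'M[R]_n).
Proof.
split; first exact: trmx1.
move=> u u0; rewrite qform1 lt_neqAle sumr_ge0 ?andbT => [|i _]; last exact: sqr_ge0.
apply: contra u0; rewrite eq_sym psumr_eq0 => [/allP h|i _]; last exact: sqr_ge0.
apply/eqP/colP => i; have := h i; rewrite mem_index_enum => /(_ isT) /=.
by rewrite sqrf_eq0 mxE => /eqP.
Qed.

Lemma psd_gram m n (A : 'M[R]_(m, n)) : psd (A^T *m A).
Proof.
move=> u; have := spd_psd (spd_1 m) (A *m u).
by rewrite !qformE bform_mulr bform_mull mul1mx.
Qed.

Lemma qformN n (A : 'M[R]_n) u : qform A (- u) = qform A u.
Proof. by rewrite !qformE bformNl bformNr opprK. Qed.

Lemma qform_mul m n (A : 'M[R]_m) (B : 'M[R]_(m, n)) u :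
  qform A (B *m u) = qform (B^T *m A *m B) u.
Proof. by rewrite !qformE bform_mulr bform_mull mulmxA. Qed.

End BilinearForms.

(** * Chebyshev bound for MINRES *)

Section Minres.
Variable R : realType.

(* The pair (T_k(x), U_(k-1)(x)) of Chebyshev polynomials of both kinds. *)
Fixpoint cheb (C : comNzRingType) (x : C) (k : nat) : C * C :=
  if k is k'.+1 then
    let: (t, u) := cheb x k' in (x * t - (1 - x ^+ 2) * u, t + x * u)
  else (1, 0).

(** The recursion multiplies $t + u w$ by $x + w$ with $w^2 = x^2 - 1$, an element of norm 1; hence
    $t^2 - (x^2-1)u^2$ stays equal to 1. *)
Lemma cheb_pell (C : comNzRingType) (x : C) k :
  (cheb x k).1 ^+ 2 = 1 - (1 - x ^+ 2) * (cheb x k).2 ^+ 2.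
Proof.
elim: k => [|k] /=; first by rewrite expr0n mulr0 subr0 expr1n.
case: (cheb x k) => t u /= IH.
have -> : (x * t - (1 - x ^+ 2) * u) ^+ 2 =
  x ^+ 2 * t ^+ 2 - (1 - x ^+ 2) * u * x * t *+ 2 + (1 - x ^+ 2) ^+ 2 * u ^+ 2.
  by ring.
have -> : (t + x * u) ^+ 2 = t ^+ 2 + x * t * u *+ 2 + x ^+ 2 * u ^+ 2 by ring.
by rewrite IH; ring.
Qed.

(** Only ring operations occur in the recursion. The morphism of interest is evaluation of
    polynomials at 0. *)
Lemma cheb_rmorph (C D : comNzRingType) (f : {rmorphism C -> D}) x k :
  cheb (f x) k = (f (cheb x k).1, f (cheb x k).2).
Proof.
elim: k => [|k /= ->] /=; first by rewrite rmorph1 rmorph0.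
by case: (cheb x k) => t u; rewrite /= rmorphB rmorphD !rmorphM rmorphB rmorphXn rmorph1.
Qed.

(** Joukowski substitution: for $x = (r + 1/r)/2$ the root of $x^2 - 1$ is $(r - 1/r)/2$. The second
    component, scaled by this root, is carried along to close the induction. *)
Lemma cheb_val (F : fieldType) (r : F) k : 2%:R != 0 :> F -> r != 0 ->
  (cheb ((r + r^-1) / 2) k).1 = (r ^+ k + r ^- k) / 2 /\
  (r - r^-1) / 2 * (cheb ((r + r^-1) / 2) k).2 = (r ^+ k - r ^- k) / 2.
Proof.
move=> n2 r0; elim: k => [|k] /=.
  by rewrite expr0 invr1 mulr0 subrr mul0r divff.
case: (cheb _ _) => t u /= [-> IH].
have rk0 : r ^+ k != 0 by rewrite expf_neq0.
have e : 1 - ((r + r^-1) / 2) ^+ 2 = - ((r - r^-1) / 2) ^+ 2 by field; rewrite n2.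
split.
  rewrite e mulNr opprK expr2 -[X in _ + X = _]mulrA IH exprS; field.
  by rewrite rk0 r0 n2.
rewrite mulrDr (mulrCA _ _ u) IH exprS; field.
by rewrite rk0 r0 n2.
Qed.

(** The second component is bounded only through the two products met in the recursion; a bound on
    it alone would have degree [d * (k - 1)], awkward at [k = 0]. *)
Lemma size_cheb (x : {poly R}) d k : (size x <= d.+1)%N ->
  (size (cheb x k).1 <= (d * k).+1)%N /\ (size ((1 - x ^+ 2) * (cheb x k).2)%R <= (d * k + d).+1)%N
  /\ (size (x * (cheb x k).2)%R <= (d * k).+1)%N.
Proof.
move=> sx.
have sM (p q : {poly R}) i j : (size p <= i.+1)%N -> (size q <= j.+1)%N ->
    (size (p * q)%R <= (i + j).+1)%N.
  move=> hp hq; apply: leq_trans (size_polyMleq _ _) _.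
  by rewrite -subn1 leq_subLR; apply: leq_trans (leq_add hp hq) _; rewrite addSn addnS.
have sB (p q : {poly R}) i : (size p <= i)%N -> (size q <= i)%N -> (size (p - q)%R <= i)%N.
  by move=> hp hq; apply: leq_trans (size_polyD _ _) _; rewrite size_polyN geq_max hp.
have sD (p q : {poly R}) i : (size p <= i)%N -> (size q <= i)%N -> (size (p + q)%R <= i)%N.
  by move=> hp hq; apply: leq_trans (size_polyD _ _) _; rewrite geq_max hp.
elim: k => [|k] /=.
  by rewrite muln0 !mulr0 size_poly0 size_poly1.
case: (cheb x k) => t u /= [h1 [h2 h3]].
have sxx : (size (1 - x ^+ 2)%R <= (d + d).+1)%N.
  by apply: sB; [rewrite size_poly1|rewrite expr2; exact: sM].
rewrite mulnS [(d + _)%N]addnC.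
have htu : (size (t + x * u)%R <= (d * k).+1)%N by apply: sD.
split; [|split].
- by apply: sB => //; rewrite addnC; apply: sM.
- by rewrite -addnA addnC; apply: sM.
- by rewrite addnC; apply: sM.
Qed.

Lemma trmx_horner_mx n (A : 'M[R]_n.+1) p : A^T = A ->
  (horner_mx A p)^T = horner_mx A p.
Proof.
move=> As; elim/poly_ind: p => [|p c IH]; first by rewrite rmorph0 trmx0.
rewrite rmorphD rmorphM /= horner_mx_X horner_mx_C -mulmxE linearD /= trmx_mul IH As tr_scalar_mx.
by congr (_ + _); rewrite -{1 4}(horner_mx_X A) mulmxE; exact: comm_horner_mx2.
Qed.

(** Puts $p(A)v$ in the shape required for membership in a Krylov space. *)
Lemma horner_mx_sum n (A : 'M[R]_n.+1) (p : {poly R}) k (v : 'cV[R]_n.+1) :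
  (size p <= k)%N ->
  horner_mx A p *m v = \sum_(i < k) p`_i *: iter i (mulmx A) v.
Proof.
move=> sp.
have -> : p = \sum_(i < k) p`_i *: 'X^i.
  rewrite -[LHS]coefK poly_def (big_ord_widen _ (fun i => p`_i *: 'X^i) sp).
  rewrite [RHS](bigID (fun i : 'I_k => (i < size p)%N)) /=.
  rewrite [X in _ = _ + X]big1 ?addr0// => i; rewrite -leqNgt => h.
  by rewrite nth_default ?scale0r.
rewrite rmorph_sum /= mulmx_suml; apply: eq_bigr => i _.
rewrite horner_mxZ -scalemxAl; congr (_ *: _).
  rewrite coef_sum (bigD1 i)//= coefZ coefXn eqxx mulr1 big1 ?addr0// => j ji.
  by rewrite coefZ coefXn eq_sym (negbTE ji : (nat_of_ord j == i) = false) mulr0.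
rewrite rmorphXn /= horner_mx_X.
elim: (nat_of_ord i) => [|j IH] /=; first by rewrite expr0 mul1mx.
by rewrite exprS -mulmxE -mulmxA IH.
Qed.

(** By commutation $c\,XY = (X+Y)XY = XYX + YXY$, a sum of two congruences of semidefinite forms; no
    matrix square root is needed. *)
Lemma psd_mul_comm n (X Y : 'M[R]_n) c : X^T = X -> Y^T = Y ->
  X *m Y = Y *m X -> X + Y = c%:M -> 0 < c -> psd X -> psd Y -> psd (X *m Y).
Proof.
move=> Xs Ys XY XYc c0 X0 Y0 u; rewrite -(pmulr_rge0 _ c0).
suff -> : c * qform (X *m Y) u = qform X (Y *m u) + qform Y (X *m u).
  by rewrite addr_ge0.
rewrite !qform_mul Xs Ys !qformE -bform_scalem -bform_addm; congr bform.
rewrite -mul_scalar_mx -XYc mulmxDl addrC; congr (_ + _).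
  by rewrite mulmxA.
by rewrite -mulmxA -XY.
Qed.

(* For a contraction B the Pell identity reads
   |T(B) v|^2 = |v|^2 - (|U(B) v|^2 - |B U(B) v|^2), so that |T(B) v| <= |v|
   without diagonalizing B. *)
Lemma cheb_contraction n (A : 'M[R]_n.+1) (l : {poly R}) k v : A^T = A ->
  psd (1 - horner_mx A l ^+ 2) ->
  qform 1%:M (horner_mx A (cheb l k).1 *m v) <= qform 1%:M v.
Proof.
move=> As Bc; rewrite qform_mul mulmx1 trmx_horner_mx// mulmxE -expr2 -rmorphXn.
have -> : (cheb l k).1 ^+ 2 = 1 - (cheb l k).2 * (1 - l ^+ 2) * (cheb l k).2.
  by rewrite cheb_pell; ring.
rewrite /= rmorphB rmorph1 !rmorphM rmorphB rmorph1 rmorphXn /=.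
rewrite !qformE -scaleN1r bform_addm bform_scalem mulN1r gerDl oppr_le0.
by have := Bc (horner_mx A (cheb l k).2 *m v); rewrite qform_mul trmx_horner_mx.
Qed.

(** The residual polynomial is $p = T_k(l)/T_k(z)$, where [l] is affine in $x^2$, maps $[b^2, a^2]$
    onto $[-1, 1]$ and satisfies $l(0) = z$. Then $p(0) = 1$ and $p(A)$ has norm at most
    $1/T_k(z)$. *)
Lemma minres_cheb_poly n (A : 'M[R]_n.+1) (a b : R) (k : nat) : A^T = A ->
  0 < b -> b < a ->
  (forall v, b ^+ 2 * qform 1%:M v <= qform 1%:M (A *m v)) ->
  (forall v, qform 1%:M (A *m v) <= a ^+ 2 * qform 1%:M v) ->
  exists2 g : {poly R}, (size g <= 2 * k)%N &
    forall v : 'cV[R]_n.+1, enorm (v - A *m (horner_mx A g *m v)) <=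
      2 * ((a / b - 1) / (a / b + 1)) ^+ k * enorm v.
Proof.
move=> As b0 ba hlo hhi.
have a0 : 0 < a by apply: lt_trans ba.
pose c := a ^+ 2 - b ^+ 2.
have c0 : 0 < c by rewrite subr_gt0 ltrXn2r// ?nnegrE ltW.
pose z := (a ^+ 2 + b ^+ 2) / c.
pose l : {poly R} := z%:P - (2 / c) *: 'X^2.
(* [r] is the inverse of the convergence factor and solves $z = (r + 1/r)/2$, so that $T_k(z) \ge
   r^k/2$; this is where the leading 2 comes from. *)
pose r := (a / b + 1) / (a / b - 1).
have qb : a / b - 1 = (a - b) / b by field; rewrite gt_eqF.
have qb' : a / b + 1 = (a + b) / b by field; rewrite gt_eqF.
have rE : r = (a + b) / (a - b).
  by rewrite /r qb qb'; field; rewrite (gt_eqF b0) gt_eqF// subr_gt0.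
have r0 : 0 < r by rewrite rE divr_gt0 ?subr_gt0// addr_gt0.
have zE : z = (r + r^-1) / 2.
  rewrite rE /z /c; field.
  rewrite (gt_eqF (addr_gt0 a0 b0)) -/c (gt_eqF c0) [a - b == 0]gt_eqF ?subr_gt0//=.
have Tz : (cheb z k).1 = (r ^+ k + r ^- k) / 2.
  by rewrite zE; case: (cheb_val k _ (lt0r_neq0 r0)) => //; rewrite pnatr_eq0.
have rk0 : 0 < r ^+ k by rewrite exprn_gt0.
have Tz0 : 0 < (cheb z k).1 by rewrite Tz divr_gt0// addr_gt0 ?invr_gt0.
pose t := (cheb z k).1.
pose p : {poly R} := t^-1 *: (cheb l k).1.
have l0 : l.[0] = z by rewrite /l hornerD hornerN hornerZ hornerC hornerXn expr0n /= mulr0 subr0.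
have p0 : p.[0] = 1.
  have : cheb l.[0] k = ((cheb l k).1.[0], (cheb l k).2.[0]).
    exact: (cheb_rmorph (horner_eval (0 : R)) l k).
  rewrite l0 => /(congr1 fst) /= h; rewrite hornerZ -h.
  by rewrite mulVf// gt_eqF.
have sl : (size l <= 3)%N.
  apply: leq_trans (size_polyD _ _) _; rewrite size_polyN geq_max.
  rewrite (leq_trans (size_polyC_leq1 _))//=.
  by apply: leq_trans (size_scale_leq _ _) _; rewrite size_polyXn.
have sp : (size p <= (2 * k).+1)%N.
  by apply: leq_trans (size_scale_leq _ _) _; exact: (size_cheb k sl).1.
(* Since $p(0) = 1$, ['X] divides [1 - p], and $p(A)v = v - A\,g(A)v$ is the residual after the
   Krylov correction $g(A)v$. *)
pose g := (1 - p) %/ 'X.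
have gX : 1 - p = g * 'X.
  by apply/esym/divpK; rewrite -['X]subr0 -polyC0 dvdp_XsubCl /root hornerD hornerN p0 -polyC1 hornerC subrr.
exists g.
  have [->|g0] := eqVneq g 0; first by rewrite size_poly0.
  have : (size (1 - p)%R <= (2 * k).+1)%N.
    by apply: leq_trans (size_polyD _ _) _; rewrite size_polyN geq_max size_poly1.
  by rewrite gX size_mulX.
move=> v.
have -> : v - A *m (horner_mx A g *m v) = horner_mx A p *m v.
  have -> : p = 1 - g * 'X by rewrite -gX opprB addrC subrK.
  rewrite rmorphB rmorph1 mulmxBl mul1mx; congr (_ - _).
  by rewrite mulrC rmorphM /= horner_mx_X mulmxA.
rewrite horner_mxZ -scalemxAl !enormE qformE bformZl bformZr mulrA -expr2 sqrtrM ?sqr_ge0//.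
rewrite sqrtr_sqr ger0_norm ?invr_ge0 ?(ltW Tz0)//.
apply: ler_pM; rewrite ?invr_ge0 ?(ltW Tz0) ?sqrtr_ge0//.
  have -> : (a / b - 1) / (a / b + 1) = r^-1 by rewrite /r invf_div.
  rewrite exprVn -[2 * _]invrK lef_pV2 ?posrE// ?invr_gt0 ?mulr_gt0 ?invr_gt0//.
  rewrite invfM invrK /t Tz mulrC ler_wpM2r ?invr_ge0// lerDl invr_ge0 ltW//.
rewrite ler_sqrt; last first.
  exact: spd_psd (spd_1 _ _) _.
apply: cheb_contraction => //.
pose X : 'M[R]_n.+1 := A *m A - (b ^+ 2)%:M.
pose Y : 'M[R]_n.+1 := (a ^+ 2)%:M - A *m A.
have AAq u : qform (A *m A) u = qform 1%:M (A *m u) by rewrite qform_mul mulmx1 As.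
have sq e u : qform (e%:M : 'M[R]_n.+1) u = e * qform 1%:M u.
  by rewrite -[e%:M]scalemx1 !qformE bform_scalem.
have scN (M : 'M[R]_n.+1) u : qform (- M) u = - qform M u.
  by rewrite !qformE -scaleN1r bform_scalem mulN1r.
have addq (M N : 'M[R]_n.+1) u : qform (M + N) u = qform M u + qform N u.
  by rewrite !qformE bform_addm.
have lA : horner_mx A l = z%:M - (2 / c) *: (A *m A).
  by rewrite /l rmorphB /= horner_mxZ horner_mx_C rmorphXn /= horner_mx_X expr2.
(* The factors $1 - l$ and $1 + l$ are multiples of $A^2 - b^2$ and $a^2 - A^2$, which commute, are
   semidefinite and add up to [c]. *)
have XY : 1 - horner_mx A l ^+ 2 = (4 / c ^+ 2) *: (X *m Y).
  have zc : z = (a ^+ 2 + b ^+ 2) / c by [].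
  rewrite lA /X /Y expr2 -!mulmxE.
  rewrite !(mulmxBl, mulmxBr) !mul_scalar_mx !mul_mx_scalar -!(scalemxAl, scalemxAr).
  rewrite scale_scalar_mx.
  set H := A *m A.
  apply/matrixP => i j; rewrite !mxE zc.
  case: (i == j); rewrite ?mulr1n ?mulr0n /c; field; by rewrite -/c gt_eqF.
have cE : c%:M = (a ^+ 2)%:M - (b ^+ 2)%:M :> 'M[R]_n.+1 by exact: raddfB.
move=> u; rewrite XY qformE bform_scalem mulr_ge0 ?divr_ge0 ?exprn_ge0 ?(ltW c0)//.
apply: (@psd_mul_comm _ _ _ c) => //.
- by rewrite /X linearB /= trmx_mul As tr_scalar_mx.
- by rewrite /Y linearB /= trmx_mul As tr_scalar_mx.
- have -> : Y = c%:M - X.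
    by rewrite cE /X /Y opprB addrA subrK.
  by move: (X) => Z; rewrite mulmxBl mulmxBr mul_scalar_mx mul_mx_scalar.
- by rewrite cE /X /Y addrC addrA subrK.
- by move=> w; rewrite /X addq scN AAq (sq (b ^+ 2)) subr_ge0; exact: hlo.
- by move=> w; rewrite /Y addq scN AAq (sq (a ^+ 2)) subr_ge0; exact: hhi.
Qed.

Lemma minres_bound n (A : 'M[R]_n) (a b : R) (rhs : 'cV[R]_n) x0 x (k : nat) :
  A^T = A -> 0 < b -> b < a ->
  (forall v, b ^+ 2 * qform 1%:M v <= qform 1%:M (A *m v)) ->
  (forall v, qform 1%:M (A *m v) <= a ^+ 2 * qform 1%:M v) ->
  minres_iterate A rhs x0 (2 * k) x ->
  enorm (rhs - A *m x) <= 2 * ((a / b - 1) / (a / b + 1)) ^+ k * enorm (rhs - A *m x0).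
Proof.
case: n A rhs x0 x => [|n] A rhs x0 x As b0 ba hlo hhi [_ hx].
  (* Matrix polynomials live in dimension [n.+1]; the empty system is treated apart. *)
  have e0 (v : 'cV[R]_0) : enorm v = 0.
    by rewrite enormE qform1 big_ord0 sqrtr0.
  by rewrite !e0 mulr0.
have [g sg hg] := minres_cheb_poly k As b0 ba hlo hhi.
set r0 := rhs - A *m x0 in hx *.
pose y := x0 + horner_mx A g *m r0.
apply: le_trans (hx y _) _.
  rewrite /y addrAC subrr add0r (horner_mx_sum _ _ sg).
  by exists (fun i => g`_i).
by apply: le_trans (hg r0); rewrite /y mulmxDr opprD addrA.
Qed.

End Minres.

(** * Spectral bounds of the saddle point matrix *)

Section BlockForms.
Variable R : realType.

Lemma invmx_uniq n (A B : 'M[R]_n) : B *m A = 1%:M -> invmx A = B.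
Proof.
move=> BA; have [_ Au] := mulmx1_unit BA.
by rewrite -[LHS]mul1mx -BA mulmxK.
Qed.

Lemma spd_invmx n (A : 'M[R]_n) : spd A -> spd (invmx A).
Proof.
move=> As; have Au := spd_unitmx As; case: As => At A0.
split; first by rewrite trmx_inv At.
move=> u u0; rewrite -[u](mulKVmx Au) qform_mul At mulmxV// mul1mx.
apply: A0; apply: contra u0 => /eqP e; by rewrite -[u](mulKVmx Au) e mulmx0.
Qed.

Lemma qform_invmx n (A : 'M[R]_n) u : spd A -> qform (invmx A) (A *m u) = qform A u.
Proof.
move=> As; rewrite qform_mul (proj1 As) mulmxV ?mul1mx//; exact: spd_unitmx.
Qed.

Lemma qform_diag m n (A : 'M[R]_m) (D : 'M[R]_n) u v :
  qform (block_mx A 0 0 D) (col_mx u v) = qform A u + qform D v.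
Proof.
rewrite /qform tr_col_mx mul_row_block !mulmx0 addr0 add0r mul_row_col.
by rewrite mxE.
Qed.

Lemma spd_diag m n (A : 'M[R]_m) (D : 'M[R]_n) :
  spd (block_mx A 0 0 D) -> spd A /\ spd D.
Proof.
rewrite /spd tr_block_mx => -[/eq_block_mx[At _ _ Dt] h]; split; split => // u u0.
- have := h (col_mx u 0); rewrite qform_diag qform0 addr0; apply.
  by rewrite col_mx_eq0 negb_and u0.
- have := h (col_mx 0 u); rewrite qform_diag qform0 add0r; apply.
  by rewrite col_mx_eq0 negb_and u0 orbT.
Qed.

Lemma invmx_diag m n (A : 'M[R]_m) (D : 'M[R]_n) : A \in unitmx -> D \in unitmx ->
  invmx (block_mx A 0 0 D) = block_mx (invmx A) 0 0 (invmx D).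
Proof.
move=> Au Du; apply: invmx_uniq.
by rewrite mulmx_block !mul0mx !mulmx0 !addr0 add0r !mulVmx// -scalar_mx_block.
Qed.

Lemma spd_eq0 n (A : 'M[R]_n) u : spd A -> qform A u <= 0 -> u = 0.
Proof. by move=> [_ h] q0; apply/eqP/negPn/negP => /h; rewrite ltNge q0. Qed.

Lemma qformD n (A : 'M[R]_n) u v : A^T = A ->
  qform A (u + v) = qform A u + 2 * bform A u v + qform A v.
Proof.
move=> At; rewrite !qformE !bformE.
by rewrite -[in bform A v u]At bform_trmx; ring.
Qed.

Lemma qformZ n (A : 'M[R]_n) a u : qform A (a *: u) = a ^+ 2 * qform A u.
Proof. by rewrite !qformE !bformE mulrA -expr2. Qed.

(** Expand the form at [t *: u - v] and divide by [t]; for the lower bound below, at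
    [t *: u + v]. *)
Lemma young_up n (A : 'M[R]_n) t u v : A^T = A -> psd A -> 0 < t ->
  qform A (u + v) <= (1 + t) * qform A u + (1 + t^-1) * qform A v.
Proof.
move=> At A0 t0; have := A0 (t *: u - v).
rewrite !qformD// qformN qformZ bformNr bformZl => h.
have : 0 <= t^-1 * (t ^+ 2 * qform A u + 2 * - (t * bform A u v) + qform A v).
  by rewrite mulr_ge0 ?invr_ge0// ltW.
have -> : t^-1 * (t ^+ 2 * qform A u + 2 * - (t * bform A u v) + qform A v) =
  t * qform A u - 2 * bform A u v + t^-1 * qform A v by field; rewrite gt_eqF.
by lra.
Qed.

Lemma young_lo n (A : 'M[R]_n) t u v : A^T = A -> psd A -> 0 < t ->
  (1 - t) * qform A u - t^-1 * qform A v <= qform A (u + v).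
Proof.
move=> At A0 t0; have := A0 (t *: u + v); have := A0 v.
rewrite !qformD// qformZ bformZl => hv h.
have : 0 <= t^-1 * (t ^+ 2 * qform A u + 2 * (t * bform A u v) + qform A v).
  by rewrite mulr_ge0 ?invr_ge0// ltW.
have -> : t^-1 * (t ^+ 2 * qform A u + 2 * (t * bform A u v) + qform A v) =
  t * qform A u + 2 * bform A u v + t^-1 * qform A v by field; rewrite gt_eqF.
by lra.
Qed.

End BlockForms.

(** * Two-sided bounds and nonsingularity for the saddle point matrix *)

Section Saddle.
Variables (R : realType) (m N : nat).
Variables (A1 : 'M[R]_m) (E M : 'M[R]_N) (B : 'M[R]_(N, m)) (eps beta C : R).
Hypotheses (A1s : spd A1) (Es : spd E) (Ms : spd M).
Hypotheses (eps0 : 0 < eps) (hE : forall y, eps * qform M y <= qform E y).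
Hypothesis beta0 : 0 < beta.
Hypothesis hinf : forall p : 'cV[R]_N,
  beta ^+ 2 * qform M p <= qform (invmx A1) (B^T *m p).
Hypothesis hkorn : forall u : 'cV[R]_m, qform (invmx M) (B *m u) <= C * qform A1 u.

(** [E] stands for the middle block of the preconditioner. Besides [Es], all that is retained of its
    structure is [hE], which expresses that its $\tilde D$ part is positive semidefinite. *)
Definition sadA : 'M[R]_(m + (N + N)) :=
  block_mx A1 (row_mx 0 (- B^T)) (col_mx 0 (- B))
    (block_mx (- E) (- (eps *: M)) (- (eps *: M)) (- (eps *: M))).

Definition sadP : 'M[R]_(m + (N + N)) := block_mx A1 0 0 (block_mx E 0 0 M).

(** [Z], [W] and [Y] are the off-diagonal blocks divided by the diagonal blocks of [sadP]: each
    block row of the saddle matrix becomes a diagonal block applied to one vector. *)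
Let Z p : 'cV[R]_m := invmx A1 *m (B^T *m p).
Let W u : 'cV[R]_N := invmx M *m (B *m u).
Let Y p : 'cV[R]_N := invmx E *m (eps *: (M *m p)).

Let A1Z p : A1 *m Z p = B^T *m p.
Proof. by rewrite mulKVmx// spd_unitmx. Qed.

Let MW u : M *m W u = B *m u.
Proof. by rewrite mulKVmx// spd_unitmx. Qed.

Let EY p : E *m Y p = eps *: (M *m p).
Proof. by rewrite mulKVmx// spd_unitmx. Qed.

Let sadA_col u y p : sadA *m col_mx u (col_mx y p) =
  col_mx (A1 *m (u - Z p))
    (col_mx (E *m (- (y + Y p))) (M *m (- (W u + eps *: (y + p))))).
Proof.
rewrite /sadA mul_block_col mul_row_col mul0mx add0r mul_col_mx mul0mx mul_block_col.
rewrite mulmxBr A1Z mulNmx add_col_mx add0r !mulmxN !mulmxDr EY MW -scalemxAr mulmxDr.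
by rewrite !mulNmx -!scalemxAl !opprD scalerDr opprD.
Qed.

(** Each block row is a diagonal block of [sadP] times a vector, so the inverse preconditioner
    cancels and three independent squares remain. *)
Lemma sadA_qform u y p :
  qform (invmx sadP) (sadA *m col_mx u (col_mx y p)) =
  qform A1 (u - Z p) + qform E (y + Y p) + qform M (W u + eps *: (y + p)).
Proof.
have u1 := spd_unitmx A1s; have u2 := spd_unitmx Es; have u3 := spd_unitmx Ms.
rewrite sadA_col /sadP invmx_diag//; last first.
  by rewrite unitmxE det_ublock unitrM -!unitmxE u2.
by rewrite invmx_diag// !qform_diag !qform_invmx// !qformN addrA.
Qed.

Lemma sadP_qform u y p :
  qform sadP (col_mx u (col_mx y p)) = qform A1 u + qform E y + qform M p.
Proof. by rewrite /sadP !qform_diag addrA. Qed.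

(** Both sides are the coupling $p^T B u$. *)
Let cZW u p : bform A1 u (Z p) = bform M p (W u).
Proof.
rewrite bform_mulr mulmxV ?spd_unitmx// [RHS]bform_mulr mulmxV ?spd_unitmx//.
by rewrite !bform_mulr !mul1mx bform_trmx.
Qed.

Let qZ p : beta ^+ 2 * qform M p <= qform A1 (Z p).
Proof. by apply: le_trans (hinf p) _; rewrite -A1Z qform_invmx. Qed.

Let qW u : qform M (W u) <= C * qform A1 u.
Proof. by apply: le_trans (hkorn u); rewrite -MW qform_invmx. Qed.

Let bEY y p : bform E y (Y p) = eps * bform M y p.
Proof.
have -> : bform E y (Y p) = bform 1%:M y (E *m Y p) by rewrite bform_mulr mul1mx.
by rewrite EY bformZr bform_mulr mul1mx.
Qed.

(** In effect $E \ge \epsilon M$ is inverted to $\epsilon^2 M E^{-1} M \le \epsilon M$. Only one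
    power of [eps] survives, whence a perturbation of norm $O(\sqrt\epsilon)$. *)
Let qY p : qform E (Y p) <= eps * qform M p.
Proof.
have h1 : qform E (Y p) = eps * bform M (Y p) p by rewrite qformE bEY.
have h2 := hE (Y p).
have := spd_psd Ms (Y p - p); rewrite qformD ?(proj1 Ms)// qformN bformNr => h3.
have : 0 <= eps * (qform M (Y p) + 2 * - bform M (Y p) p + qform M p).
  by rewrite mulr_ge0// ltW.
by lra.
Qed.

(** One factor [eps] is spent on [y] to pass from [M] to [E]; on [p] it is bounded by 1. *)
Let qeps (y p : 'cV[R]_N) : eps <= 1 -> qform M (eps *: (y + p)) <= 2 * eps * (qform E y + qform M p).
Proof.
move=> e1; have h : qform M (y + p) <= 2 * (qform M y + qform M p).
  have := @young_up _ _ M 1 y p (proj1 Ms) (spd_psd Ms) ltr01.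
  by rewrite invr1; lra.
rewrite qformZ; apply: le_trans (ler_wpM2l (sqr_ge0 _) h) _.
have := hE y; have := spd_psd Ms p; move: (qform M y) (qform M p) (qform E y) => a b c b0 ac.
rewrite mulrCA -mulrA ler_pM2l// expr2 -mulrA ler_pM2l// mulrDr lerD//.
by rewrite ler_piMl.
Qed.

(* Equality holds, for s(1+s) = beta^2, on eigenvectors of the saddle point
   problem with eps = 0, for the smallest eigenvalue modulus s; this dictates
   the two instances of Young's inequality. *)
Let limit_lo (s : R) u p : 0 < s -> s <= 1 -> s * (1 + s) <= beta ^+ 2 ->
  s ^+ 2 * (qform A1 u + qform M p) <= qform A1 (u - Z p) + qform M (W u).
Proof.
move=> s0 s1 hs.
have At := proj1 A1s; have Mt := proj1 Ms.
have y1 := spd_psd Ms (W u - s *: p).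
have y2 := spd_psd A1s ((1 + s) *: u - Z p).
have := qZ p; have := spd_psd Ms p; move: y1 y2.
rewrite !qformD// !qformN !qformZ !bformNr bformZl bformZr cZW.
rewrite -[bform M (W u) p]bform_trmx Mt.
move: (qform A1 u) (qform M p) (qform A1 (Z p)) (qform M (W u)) (bform M p (W u)).
move=> X q g w c y1 y2 q0 hg; rewrite -subr_ge0.
(* A certificate: the square of $Wu - sp$, the square of $(1+s)u - Zp$ with a weight that is
   nonnegative as $s \le 1$, and the surplus in the inf-sup bound. *)
have -> : X + 2 * - c + g + w - s ^+ 2 * (X + q) =
  (w + 2 * - (s * c) + s ^+ 2 * q) +
  (1 - s) / (1 + s) * ((1 + s) ^+ 2 * X + 2 * - ((1 + s) * c) + g) +
  2 * s / (1 + s) * (g - s * (1 + s) * q).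
  by field; rewrite gt_eqF// addr_gt0.
have s2 : 0 < 1 + s by rewrite addr_gt0.
apply: addr_ge0.
  apply: addr_ge0 => //.
  by rewrite mulr_ge0// divr_ge0 ?subr_ge0 ?(ltW s2).
rewrite mulr_ge0 ?divr_ge0 ?mulr_ge0 ?(ltW s2) ?(ltW s0)// subr_ge0.
by apply: le_trans hg; rewrite ler_wpM2r.
Qed.

(** Expanding the square of $W(Zp) - tp$ transfers the Korn bound to the pressure side; $t = C$
    gives $BA_1^{-1}B^T \le CM$. *)
Let qZ_le (t : R) p : (2 * t - C) * qform A1 (Z p) <= t ^+ 2 * qform M p.
Proof.
have := spd_psd Ms (W (Z p) - t *: p); have := qW (Z p).
rewrite qformD ?(proj1 Ms)// qformN qformZ bformNr bformZr.
rewrite -[bform M (W _) p]bform_trmx (proj1 Ms) -cZW -qformE.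
by lra.
Qed.

(** Taking $t = \beta^2$ in [qZ_le] and comparing with the inf-sup bound forces $\beta^2 \le C$, as
    soon as a nonzero pressure exists. *)
Lemma korn_gt0 (p : 'cV[R]_N) : p != 0 -> 0 < C.
Proof.
move=> p0; have b2 : 0 < beta ^+ 2 by rewrite exprn_gt0.
have q0 : 0 < qform M p by exact: (proj2 Ms).
have := qZ p; have := qZ_le (beta ^+ 2) p.
move: (qform M p) (qform A1 (Z p)) q0 => q g q0 h1 h2.
have g0 : 0 < g by apply: lt_le_trans h2; rewrite mulr_gt0.
rewrite -(pmulr_lgt0 _ g0).
have : beta ^+ 2 * (beta ^+ 2 * q) <= beta ^+ 2 * g by rewrite ler_pM2l.
have : 0 < beta ^+ 2 * g by rewrite mulr_gt0.
by lra.
Qed.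

(** Counterpart of the lower bound: an eigenvector for the eigenvalue [d] of the limit problem
    satisfies $(d-1)u + Zp = 0$, which selects the square to be completed. The remaining terms are
    surpluses of the Korn bound in both of its forms. *)
Let limit_hi (d : R) u p : 1 < d -> C <= d * (d - 1) -> 0 < C ->
  qform A1 (u - Z p) + qform M (W u) <= d ^+ 2 * (qform A1 u + qform M p).
Proof.
move=> d1 hd C0.
have d0 : 0 < d - 1 by rewrite subr_gt0.
have At := proj1 A1s.
have y2 := spd_psd A1s ((d - 1) *: u + Z p).
have := qW u; have := qZ_le C p; have := spd_psd Ms p; have := spd_psd A1s u.
move: y2; rewrite !qformD// qformN qformZ bformNr bformZl.
move: (qform A1 u) (qform M p) (qform A1 (Z p)) (qform M (W u)) (bform A1 u (Z p)).
move=> X q g w c y2 X0 q0 hg hw; rewrite -subr_ge0.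
have gC : g <= C * q.
  by rewrite -(ler_pM2l C0) mulrA -expr2; lra.
have -> : d ^+ 2 * (X + q) - (X + 2 * - c + g + w) =
  (d - 1)^-1 * ((d - 1) ^+ 2 * X + 2 * ((d - 1) * c) + g) + (C * X - w) +
   (d * (d - 1) - C) * X + (d - 1)^-1 * (d * (C * q - g) + d * (d * (d - 1) - C) * q).
  by field; rewrite gt_eqF.
have d0' : 0 < d by lra.
have di : 0 <= (d - 1)^-1 by rewrite invr_ge0 ltW.
have hd' : 0 <= d * (d - 1) - C by rewrite subr_ge0.
apply: addr_ge0; first apply: addr_ge0; first apply: addr_ge0.
- exact: mulr_ge0.
- by rewrite subr_ge0.
- exact: mulr_ge0.
- by rewrite mulr_ge0// addr_ge0// !mulr_ge0 ?subr_ge0// ltW.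
Qed.

Let block3P (w : 'cV[R]_(m + (N + N))) : exists u y p, w = col_mx u (col_mx y p).
Proof.
by exists (usubmx w), (usubmx (dsubmx w)), (dsubmx (dsubmx w)); rewrite !vsubmxK.
Qed.

(** The [eps = 0] bound, with Young's inequality of parameter [t] splitting off the terms in [eps]:
    [qY] contributes [eps] and [qeps] contributes [2 * eps], each divided by [t]. *)
Lemma saddle_lo (s t : R) w : 0 < s -> s <= 1 -> s * (1 + s) <= beta ^+ 2 ->
  0 < t -> t <= 1 -> eps <= 1 ->
  ((1 - t) * s ^+ 2 - 3 * eps / t) * qform sadP w <= qform (invmx sadP) (sadA *m w).
Proof.
move=> s0 s1 hs t0 t1 e1.
have [u [y [p ->]]] := block3P w.
rewrite sadA_qform sadP_qform.
have l1 := limit_lo u p s0 s1 hs.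
have l2 := young_lo y (Y p) (proj1 Es) (spd_psd Es) t0.
have l3 := young_lo (W u) (eps *: (y + p)) (proj1 Ms) (spd_psd Ms) t0.
have t0' : 0 < t^-1 by rewrite invr_gt0.
have l4 := qY p; have l5 := qeps y p e1; rewrite -(ler_pM2l t0') in l4; rewrite -(ler_pM2l t0') in l5.
have q1 := spd_psd A1s (u - Z p); have q2 := spd_psd Es y.
have q3 := spd_psd A1s u; have q4 := spd_psd Ms p.
have h1 : (1 - t) * (s ^+ 2 * (qform A1 u + qform M p)) <= (1 - t) * (qform A1 (u - Z p) + qform M (W u)).
  by rewrite ler_wpM2l// subr_ge0.
(* At [eps = 0] the middle block has modulus 1, which $s \le 1$ covers. *)
have h2 : (1 - t) * (s ^+ 2 * qform E y) <= (1 - t) * qform E y.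
  by rewrite ler_wpM2l ?subr_ge0// ler_piMl// expr_le1// ltW.
have h3 : 0 <= t * qform A1 (u - Z p) by rewrite mulr_ge0// ltW.
have h4 : 0 <= t^-1 * (eps * (3 * qform A1 u + qform E y)).
  by rewrite mulr_ge0 ?(ltW t0')// mulr_ge0 ?(ltW eps0)// addr_ge0// mulr_ge0.
move: l1 l2 l3 l4 l5 h1 h2 h3 h4.
move: (qform A1 u) (qform M p) (qform E y) (qform A1 _) (qform M (W u)) (qform M (_ + _))
  (qform E (y + _)) (qform E (Y p)) (qform M _) => X q yy a1 w1 a2 a3 a4 a5.
move: (t^-1) => ti.
by lra.
Qed.

Lemma saddle_hi (d t : R) w : 1 < d -> C <= d * (d - 1) -> 0 < C ->
  0 < t -> eps <= 1 ->
  qform (invmx sadP) (sadA *m w) <= ((1 + t) * d ^+ 2 + 3 * eps * (1 + t^-1)) * qform sadP w.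
Proof.
move=> d1 hd C0 t0 e1.
have [u [y [p ->]]] := block3P w.
rewrite sadA_qform sadP_qform.
have l1 := limit_hi u p d1 hd C0.
have l2 := young_up y (Y p) (proj1 Es) (spd_psd Es) t0.
have l3 := young_up (W u) (eps *: (y + p)) (proj1 Ms) (spd_psd Ms) t0.
have t0' : 0 < 1 + t^-1 by rewrite addr_gt0 ?invr_gt0.
have l4 := qY p; have l5 := qeps y p e1; rewrite -(ler_pM2l t0') in l4; rewrite -(ler_pM2l t0') in l5.
have q1 := spd_psd A1s (u - Z p); have q2 := spd_psd Es y.
have q3 := spd_psd A1s u; have q4 := spd_psd Ms p.
have h1 : (1 + t) * (qform A1 (u - Z p) + qform M (W u)) <= (1 + t) * (d ^+ 2 * (qform A1 u + qform M p)).
  by rewrite ler_pM2l ?addr_gt0.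
have h2 : (1 + t) * qform E y <= (1 + t) * (d ^+ 2 * qform E y).
  by rewrite ler_pM2l ?addr_gt0// ler_peMl// exprn_ege1// ltW.
have h3 : 0 <= t * qform A1 (u - Z p) by rewrite mulr_ge0// ltW.
have h4 : 0 <= (1 + t^-1) * (eps * (3 * qform A1 u + qform E y)).
  by rewrite mulr_ge0 ?(ltW t0')// mulr_ge0 ?(ltW eps0)// addr_ge0// mulr_ge0.
move: l1 l2 l3 l4 l5 h1 h2 h3 h4.
move: (qform A1 u) (qform M p) (qform E y) (qform A1 _) (qform M (W u)) (qform M (_ + _))
  (qform E (y + _)) (qform E (Y p)) (qform M _) => X q yy a1 w1 a2 a3 a4 a5.
move: (t^-1) => ti.
by lra.
Qed.

(** On a kernel vector all three squares vanish, so $u = Zp$, $y = -Yp$ and $Wu = -\epsilon(y+p)$.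
    Pairing these relations and using $M \ge 0$ at $y + p$ gives $u = 0$; the inf-sup bound then
    removes $p$. No smallness of [eps] enters. *)
Lemma sadA_unitmx : sadA \in unitmx.
Proof.
have inj (w : 'cV[R]_(m + (N + N))) : sadA *m w = 0 -> w = 0.
  have [u [y [p ->]]] := block3P w => /(congr1 (fun v => qform (invmx sadP) v)); rewrite sadA_qform qform0 => h.
  have q1 := spd_psd A1s (u - Z p); have q2 := spd_psd Es (y + Y p).
  have q3 := spd_psd Ms (W u + eps *: (y + p)).
  have /(spd_eq0 A1s)/eqP : qform A1 (u - Z p) <= 0 by lra.
  have /(spd_eq0 Es)/eqP : qform E (y + Y p) <= 0 by lra.
  have /(spd_eq0 Ms)/eqP : qform M (W u + eps *: (y + p)) <= 0 by lra.
  rewrite addr_eq0 => /eqP wE; rewrite addr_eq0 => /eqP yE; rewrite subr_eq0 => /eqP uE.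
  have c1 : qform A1 u = - (eps * (bform M p y + qform M p)).
    by rewrite !qformE {2}uE cZW wE bformNr bformZr bformDr.
  have c2 : qform E y = - (eps * bform M y p).
    by rewrite -bEY -bformNr -yE qformE.
  have c3 : bform M y p = bform M p y by rewrite -bform_trmx (proj1 Ms).
  have := spd_psd Ms (y + p); rewrite qformD ?(proj1 Ms)// => h3.
  have h4 := mulr_ge0 (ltW eps0) h3; have h5 := hE y; rewrite c3 in c2 h4.
  have u0 : u = 0 by apply: (spd_eq0 A1s); lra.
  have p0 : p = 0.
    apply: (spd_eq0 Ms); rewrite -(pmulr_rle0 _ (exprn_gt0 2 beta0)).
    by apply: le_trans (qZ p) _; rewrite -uE u0 qform0.
  have y0 : y = 0 by rewrite yE p0 /Y mulmx0 scaler0 mulmx0 oppr0.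
  by rewrite u0 y0 p0 !col_mx0.
rewrite -unitmx_tr -row_free_unit -kermx_eq0; apply/eqP/row_matrixP => i.
rewrite row0; apply: trmx_inj; rewrite trmx0; apply: inj.
by apply: trmx_inj; rewrite trmx_mul trmxK -row_mul mulmx_ker row0 trmx0.
Qed.

End Saddle.

(** * Integrals over sets of finite volume *)

Section Integration.
Variables (R : realType) (n : nat).
Implicit Types (D : set 'rV[R]_n) (f g : 'rV[R]_n -> R).

Definition tuples D : set (n.-tuple R) := [set t | D (row_of t)].

(** A class closed under sums and products that guarantees integrability on sets of finite
    volume. *)
Definition tame D f : Prop :=
  measurable_fun setT (fun t : n.-tuple R => f (row_of t)) /\
  exists C, forall x, D x -> `|f x| <= C.

Definition finite_volume D : Prop :=
  measurable (tuples D) /\ (lebesgue_tuple R n (tuples D) < +oo)%E.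

Lemma tame_cst D c : tame D (fun=> c).
Proof. by split=> [|]; [exact: measurable_cst | exists `|c|]. Qed.

Lemma tameD D f g : tame D f -> tame D g -> tame D (fun x => f x + g x).
Proof.
move=> [mf [a ha]] [mg [b hb]]; split; first exact: measurable_funD.
exists (a + b) => x Dx; apply: le_trans (ler_normD _ _) _.
by apply: lerD; [exact: ha|exact: hb].
Qed.

Lemma tameM D f g : tame D f -> tame D g -> tame D (fun x => f x * g x).
Proof.
move=> [mf [a ha]] [mg [b hb]]; split; first exact: measurable_funM.
by exists (a * b) => x Dx; rewrite normrM ler_pM ?ha ?hb.
Qed.

Lemma tame_sum D (I : finType) (F : I -> 'rV[R]_n -> R) :
  (forall i, tame D (F i)) -> tame D (fun x => \sum_i F i x).
Proof.
move=> hF; elim: (index_enum I) => [|i s IH].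
  by under eq_fun do rewrite big_nil; exact: tame_cst.
by under eq_fun do rewrite big_cons; exact: tameD.
Qed.

Lemma measurable_coord (i : 'I_n) :
  measurable_fun setT (fun t : n.-tuple R => row_of t 0 i).
Proof. by under eq_fun do rewrite /row_of mxE; exact: measurable_tnth. Qed.

Lemma tame_coord D (i : 'I_n) :
  (exists C, forall x, D x -> `|x 0 i| <= C) -> tame D (fun x => x 0 i).
Proof. by split => //; exact: measurable_coord. Qed.

Lemma integral_on_ge0 D f : (forall x, D x -> 0 <= f x) -> 0 <= integral_on D f.
Proof. by move=> f0; apply: Rintegral_ge0 => t; exact: f0. Qed.

Section FiniteVolume.
Variable D : set 'rV[R]_n.
Hypothesis hD : finite_volume D.

Lemma tame_integrable f : tame D f ->
  (lebesgue_tuple R n).-integrable (tuples D) (EFin \o (fun t => f (row_of t))).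
Proof.
move=> [mf [C hC]]; apply: measurable_bounded_integrable.
- exact: hD.1.
- exact: hD.2.
- exact: measurable_funTS.
- exists C; split; first exact: num_real.
  by move=> M CM t Dt /=; apply: le_trans (ltW CM); exact: hC.
Qed.

Lemma integral_on_cst c :
  integral_on D (fun=> c) = c * fine (lebesgue_tuple R n (tuples D)).
Proof. by rewrite /integral_on Rintegral_cst//; exact: hD.1. Qed.

Lemma integral_onD f g : tame D f -> tame D g ->
  integral_on D (fun x => f x + g x) = integral_on D f + integral_on D g.
Proof.
by move=> tf tg; apply: RintegralD; [exact: hD.1|exact: tame_integrable..].
Qed.

Lemma integral_onZ c f : tame D f ->
  integral_on D (fun x => c * f x) = c * integral_on D f.
Proof. by move=> tf; apply: RintegralZl; [exact: hD.1|exact: tame_integrable]. Qed.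

Lemma integral_on_eq0 f : tame D f -> (forall x, D x -> 0 <= f x) ->
  integral_on D f = 0 ->
  lebesgue_tuple R n (tuples (D `&` [set x | f x != 0])) = 0%E.
Proof.
move=> tf f0 If0; have [mf _] := tf.
have fi := tame_integrable tf.
have mDf : measurable (tuples (D `&` [set x | f x != 0])).
  rewrite (_ : tuples _ = tuples D `&` ((fun t => f (row_of t)) @^-1` [set r | r != 0])).
    rewrite -[X in _ `&` X]setTI; apply: measurableI; first exact: hD.1.
    apply: mf => //; rewrite (_ : [set r : R | r != 0] = ~` [set 0]).
      exact: measurableC.
    by apply/seteqP; split => r /= /eqP.
  by [].
have h : (\int[lebesgue_tuple R n]_(t in tuples D) `|(f (row_of t))%:E| = 0)%E.
  transitivity (\int[lebesgue_tuple R n]_(t in tuples D) (f (row_of t))%:E)%E.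
    apply: eq_integral => t; rewrite inE => Dt.
    by rewrite gee0_abs// lee_fin f0.
  rewrite -(fineK (integrable_fin_num hD.1 fi)).
  by congr EFin; exact: If0.
have mf' : measurable_fun (tuples D) (fun t : n.-tuple R => (f (row_of t))%:E).
  by apply/measurable_EFinP; exact: measurable_funTS.
have [N [mN N0 sub]] := (ae_eq_integral_abs (lebesgue_tuple R n) hD.1 mf').1 h.
apply: (subset_measure0 mDf mN _ N0) => t [/= Dt /eqP ft0].
by apply: sub => /= /(_ Dt) [].
Qed.

End FiniteVolume.

(* A measure of value +oo has finite part 0. *)
Lemma fine_finite_volume D : measurable (tuples D) -> 0 < integral_on D (cst 1) ->
  finite_volume D /\ (0 < lebesgue_tuple R n (tuples D))%E.
Proof.
move=> mD; rewrite /integral_on Rintegral_cst// mul1r => h.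
have key (x : \bar R) : (0 <= x)%E -> 0 < fine x -> (x < +oo)%E /\ (0 < x)%E.
  by case: x => [r| |]//=; rewrite ?ltxx// lte_fin ltry.
by have [] := key _ (measure_ge0 (lebesgue_tuple R n) (tuples D)) h.
Qed.

End Integration.

(** The hyperplane is a product whose first factor is a point, a Lebesgue null set. *)
Lemma lebesgue_tuple_hyperplane (R : realType) (n : nat) (c : R) :
  lebesgue_tuple R n.+1 (tuples [set x : 'rV[R]_n.+1 | x 0 0 = c]) = 0%E.
Proof.
have -> : lebesgue_tuple R n.+1 (tuples [set x : 'rV[R]_n.+1 | x 0 0 = c]) =
  (lebesgue_measure \x lebesgue_tuple R n)%E ([set c] `*` [set: n.-tuple R]).
  rewrite /= /tuple_cons_measure /pushforward; congr (_ _).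
  by apply/seteqP; split => [[a t]|[a t]] /=; rewrite /tuples /row_of /= mxE tnth0 //; case.
by rewrite product_measure1E// [X in (X * _)%E](lebesgue_measure_set1 c) mul0e.
Qed.

(** * Raviart-Thomas fields on a simplex *)

Section LinearForms.
Variable R : realType.

Lemma col_sum_delta n (c : 'cV[R]_n) : c = \sum_i c i 0 *: delta_mx i 0.
Proof.
rewrite [LHS]matrix_sum_delta; apply: eq_bigr => i _.
by rewrite big_ord1.
Qed.

Lemma linear_formE n (L : 'cV[R]_n -> R) :
  (forall a c d, L (a *: c + d) = a * L c + L d) ->
  forall c, L c = \sum_i c i 0 * L (delta_mx i 0).
Proof.
move=> hL.
have L0 : L 0 = 0.
  by have := hL 1 0 0; rewrite scaler0 addr0 mul1r; move: (L 0) => x; lra.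
move=> c; rewrite {1}[c]col_sum_delta; elim/big_rec2 : _ => [//|i y d _ <-].
exact: hL.
Qed.

Lemma bform_delta m n (A : 'M[R]_(m, n)) i j :
  bform A (delta_mx i 0) (delta_mx j 0) = A i j.
Proof. by rewrite /bform trmx_delta -rowE -colE !mxE. Qed.

Lemma bilinear_formE m n (F : 'cV[R]_m -> 'cV[R]_n -> R) :
  (forall a c c' d, F (a *: c + c') d = a * F c d + F c' d) ->
  (forall a c d d', F c (a *: d + d') = a * F c d + F c d') ->
  forall c d, F c d = bform (\matrix_(i, j) F (delta_mx i 0) (delta_mx j 0)) c d.
Proof.
move=> hl hr c d; set A := \matrix_(_, _) _.
rewrite (linear_formE (fun a u v => hl a u v d)).
rewrite [RHS](@linear_formE _ (fun u => bform A u d)); last first.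
  by move=> a u v; rewrite bformDl bformZl.
apply: eq_bigr => i _; congr (_ * _).
rewrite (linear_formE (fun a u v => hr a (delta_mx i 0) u v)).
rewrite [RHS](@linear_formE _ (fun v => bform A (delta_mx i 0) v)); last first.
  by move=> a u v; rewrite bformDr bformZr.
by apply: eq_bigr => j _; rewrite bform_delta mxE.
Qed.

Lemma dotvDl n (u v w : 'rV[R]_n) : dotv (u + v) w = dotv u w + dotv v w.
Proof. by rewrite /dotv -big_split; apply: eq_bigr => i _; rewrite mxE mulrDl. Qed.

Lemma dotvZl n a (u w : 'rV[R]_n) : dotv (a *: u) w = a * dotv u w.
Proof. by rewrite /dotv mulr_sumr; apply: eq_bigr => i _; rewrite mxE mulrA. Qed.

Lemma dotvC n (u w : 'rV[R]_n) : dotv u w = dotv w u.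
Proof. by apply: eq_bigr => i _; rewrite mulrC. Qed.

Lemma dotvNl n (u w : 'rV[R]_n) : dotv (- u) w = - dotv u w.
Proof. by rewrite -scaleN1r dotvZl mulN1r. Qed.

Lemma dotv0l n (w : 'rV[R]_n) : dotv 0 w = 0.
Proof. by rewrite /dotv big1// => i _; rewrite mxE mul0r. Qed.

Lemma dotv_eq0 n (u : 'rV[R]_n) : (dotv u u == 0) = (u == 0).
Proof.
apply/idP/eqP => [|->]; last by rewrite dotv0l.
rewrite psumr_eq0 => [/allP h|i _]; last by rewrite -expr2 sqr_ge0.
apply/rowP => i; have := h i; rewrite mem_index_enum => /(_ isT) /=.
by rewrite -expr2 sqrf_eq0 mxE => /eqP.
Qed.

Lemma dotv_ge0 n (u : 'rV[R]_n) : 0 <= dotv u u.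
Proof. by rewrite sumr_ge0// => i _; rewrite -expr2 sqr_ge0. Qed.

Lemma enorm_row n (u : 'rV[R]_n) : enorm u = Num.sqrt (dotv u u).
Proof.
by rewrite /enorm big_ord1; congr Num.sqrt; apply: eq_bigr => i _; rewrite expr2.
Qed.

Lemma enorm_row_gt0 n (u : 'rV[R]_n) : u != 0 -> 0 < enorm u.
Proof. by move=> u0; rewrite enorm_row sqrtr_gt0 lt_neqAle dotv_ge0 eq_sym dotv_eq0 u0. Qed.

End LinearForms.

Section RaviartThomas.
Variables (R : realType) (n : nat).

(** Coordinates on $RT_0$: the constant part on top, the coefficient of $x$ last. Weak gradients
    thereby become column vectors. *)
Definition rtf (c : 'cV[R]_(n.+1 + 1)) (x : 'rV[R]_n.+1) : 'rV[R]_n.+1 :=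
  (usubmx c)^T + dsubmx c 0 0 *: x.

Lemma rtf_linear a c d x : rtf (a *: c + d) x = a *: rtf c x + rtf d x.
Proof.
by apply/rowP => i; rewrite /rtf !mxE; ring.
Qed.

Lemma RT0P w : RT0 w <-> exists c, w = rtf c.
Proof.
split=> [[a [b ->]]|[c ->]].
  exists (col_mx a^T b%:M); apply/funext => x.
  by rewrite /rtf col_mxKu col_mxKd trmxK mxE mulr1n.
by exists (usubmx c)^T, (dsubmx c 0 0).
Qed.

(** A nonzero field $a + bx$ has no zero if $b = 0$ and only $-a/b$ otherwise. The first coordinate
    suffices to place the zeros in a null hyperplane. *)
Lemma rtf_eq0 c x : c != 0 -> rtf c x = 0 ->
  x 0 0 = - (usubmx c 0 0 / dsubmx c 0 0).
Proof.
move=> c0 h.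
have b0 : dsubmx c 0 0 != 0.
  apply: contra c0 => /eqP b0; move: h; rewrite /rtf b0 scale0r addr0 => a0.
  rewrite -[c]vsubmxK col_mx_eq0 -[usubmx c]trmxK a0 trmx0 eqxx /=.
  by apply/eqP/matrixP => i j; rewrite !ord1 b0 mxE.
have : usubmx c 0 0 + dsubmx c 0 0 * x 0 0 = 0.
  by move/rowP: h => /(_ 0); rewrite !mxE.
move: (usubmx c 0 0) (dsubmx c 0 0) (x 0 0) b0 => a b y b0 /eqP.
by rewrite addr_eq0 => /eqP ->; rewrite mulNr opprK mulrAC divff// mul1r.
Qed.

Lemma divergence_rtf c x : divergence (rtf c) x = dsubmx c 0 0 * n.+1%:R.
Proof.
have E : 'd (rtf c) x = (fun y => dsubmx c 0 0 *: y) :> ('rV[R]_n.+1 -> 'rV[R]_n.+1).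
  have h := is_diffD (@is_diff_cst R _ 'rV[R]_n.+1 (usubmx c)^T x)
    (@is_diffZ R _ _ _ _ (dsubmx c 0 0) x (@is_diff_id R 'rV[R]_n.+1 x)).
  by have := @diff_val _ _ _ _ _ _ _ h; rewrite add0r => e; exact: e.
rewrite /divergence /jacobian /mxtrace.
rewrite (eq_bigr (fun=> dsubmx c 0 0)); last first.
  by move=> i _; rewrite mxE E !mxE ?eqxx mulr1.
by rewrite sumr_const card_ord mulr_natr.
Qed.

Lemma tame_rtf_dot (D : set 'rV[R]_n.+1) c d :
  (forall i, tame D (fun x => x 0 i)) ->
  tame D (fun x => dotv (rtf c x) (rtf d x)).
Proof.
move=> hD.
have hc e i : tame D (fun x => rtf e x 0 i).
  under eq_fun do rewrite /rtf !mxE.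
  by apply: tameD; [exact: tame_cst|apply: tameM => //; exact: tame_cst].
by apply: tame_sum => i; exact: tameM.
Qed.

End RaviartThomas.

(** * Barycentric coordinates and the Raviart-Thomas Gram matrix of a cell *)

Section Cell.
Variables (R : realType) (n : nat) (T : mesh R n) (K : 'I_(n_elem T)).
Hypothesis Ku : vertex_mx K \in unitmx.

Let vertex_row (i : 'I_n.+2) :
  row_mx 1%:M (point (cell K i)) = row (i : 'I_(1 + n.+1)) (vertex_mx K).
Proof. by apply/rowP => k; rewrite !mxE. Qed.

Lemma bary_vertex (i j : 'I_n.+2) : bary K j (point (cell K i)) = (i == j)%:R.
Proof. by rewrite /bary vertex_row -row_mul mulmxV// !mxE. Qed.

Lemma bary_affine j x : bary K j x =
  invmx (vertex_mx K) (lshift n.+1 (0 : 'I_1)) j + dotv x (grad_bary K j).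
Proof.
rewrite /bary mxE big_split_ord /= big_ord1 row_mxEl mxE mulr1n mul1r; congr (_ + _).
by apply: eq_bigr => k _; rewrite row_mxEr mxE.
Qed.

Let baryE x : row_mx (1%:M : 'rV[R]_1) x = (\row_j bary K j x : 'rV[R]_(1 + n.+1)) *m vertex_mx K.
Proof.
rewrite -[LHS](mulmxKV Ku); congr (_ *m _).
by apply/rowP => j; rewrite [RHS]mxE.
Qed.

Lemma bary_sum x : \sum_j bary K j x = 1.
Proof.
have := congr1 (fun r : 'rV[R]_(1 + n.+1) => r 0 (lshift n.+1 0)) (baryE x).
rewrite /= row_mxEl mxE mulr1n mxE => ->; apply: eq_bigr => j _.
by rewrite mxE [vertex_mx K _ _]mxE row_mxEl mxE mulr1n mulr1.
Qed.

Lemma bary_coord (x : 'rV[R]_n.+1) k : x 0 k = \sum_j bary K j x * point (cell K j) 0 k.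
Proof.
have := congr1 (fun r : 'rV[R]_(1 + n.+1) => r 0 (rshift 1 k)) (baryE x).
rewrite /= row_mxEr mxE => ->; apply: eq_bigr => j _.
by rewrite mxE [vertex_mx K _ _]mxE row_mxEr.
Qed.

(** A barycentric coordinate is affine, so its gradient along an edge is the difference of its
    vertex values. *)
Lemma grad_bary_edge (a b j : 'I_n.+2) :
  dotv (point (cell K a) - point (cell K b)) (grad_bary K j) =
  (a == j)%:R - (b == j)%:R.
Proof.
by rewrite -!bary_vertex !bary_affine dotvDl dotvNl; ring.
Qed.

Lemma grad_bary_neq0 j : grad_bary K j != 0.
Proof.
apply/eqP => g0; have := grad_bary_edge j (lift j ord0) j.
rewrite g0 dotvC dotv0l eqxx eq_sym (negbTE (neq_lift _ _)) subr0 => /esym/eqP.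
by rewrite oner_eq0.
Qed.

Definition cell_interior : set 'rV[R]_n.+1 := [set x | forall j, 0 < bary K j x].

Lemma measurable_cell : measurable (tuples cell_interior).
Proof.
rewrite (_ : tuples _ =
  \bigcap_(j in [set: 'I_n.+2]) ((fun t => bary K j (row_of t)) @^-1` `]0, +oo[)).
  apply: fin_bigcap_measurable => // j _; rewrite -[X in measurable X]setTI.
  have [mb _] : tame set0 (bary K j).
    rewrite (funext (bary_affine j)).
    apply: tameD; first exact: tame_cst.
    apply: tame_sum => k; apply: tameM; last exact: tame_cst.
    by apply: tame_coord; exists 0.
  by apply: mb => //; exact: measurable_itv.
apply/seteqP; split => [t ht j _|t ht j].
  by rewrite /= in_itv /= andbT; exact: ht.
by have := ht j I; rewrite /= in_itv /= andbT.
Qed.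

Lemma tame_cell_coord k : tame cell_interior (fun x => x 0 k).
Proof.
apply: tame_coord; exists (\sum_j `|point (cell K j) 0 k|) => x hx.
rewrite bary_coord; apply: le_trans (ler_norm_sum _ _ _) _; apply: ler_sum => j _.
rewrite normrM ler_piMl// ger0_norm ?(ltW (hx j))//.
by rewrite -(bary_sum x) (bigD1 j)//= lerDl sumr_ge0// => i _; exact: ltW.
Qed.

Definition rt_gram : 'M[R]_(n.+1 + 1) :=
  \matrix_(i, j) elem_int K (fun x => dotv (rtf (delta_mx i 0) x) (rtf (delta_mx j 0) x)).

Hypothesis vol0 : 0 < volume K.

Let hK : finite_volume cell_interior.
Proof. by have [] := fine_finite_volume measurable_cell vol0. Qed.

Lemma rt_gramE c d :
  elem_int K (fun x => dotv (rtf c x) (rtf d x)) = bform rt_gram c d.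
Proof.
have tm c' d' : tame cell_interior (fun x => dotv (rtf c' x) (rtf d' x)).
  by apply: tame_rtf_dot; exact: tame_cell_coord.
have tz a c' d' : tame cell_interior (fun x => a * dotv (rtf c' x) (rtf d' x)).
  by apply: tameM => //; exact: tame_cst.
pose F c d := elem_int K (fun x => dotv (rtf c x) (rtf d x)).
have hl a c1 c2 d' : F (a *: c1 + c2) d' = a * F c1 d' + F c2 d'.
  rewrite /F /elem_int -(integral_onZ hK)// -(integral_onD hK)//.
  by congr integral_on; apply/funext => x; rewrite rtf_linear dotvDl dotvZl.
have FC c1 c2 : F c1 c2 = F c2 c1.
  by rewrite /F /elem_int; congr integral_on; apply/funext => x; rewrite dotvC.
rewrite -/(F c d) (@bilinear_formE _ _ _ F)// => a c1 d1 d2.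
by rewrite FC hl !(FC _ c1).
Qed.

(** A field of zero energy vanishes almost everywhere on the cell, whereas the zeros of a nonzero
    field are null and the cell has positive volume. *)
Lemma rt_gram_spd : spd rt_gram.
Proof.
split.
  apply/matrixP => i j; rewrite !mxE; congr elem_int; apply/funext => x.
  by rewrite dotvC.
move=> c c0; rewrite lt_neqAle qformE -rt_gramE integral_on_ge0 ?andbT; last first.
  by move=> x _; exact: dotv_ge0.
apply/eqP => /esym I0.
have tm : tame cell_interior (fun x => dotv (rtf c x) (rtf c x)).
  by apply: tame_rtf_dot; exact: tame_cell_coord.
have N0 := integral_on_eq0 hK tm (fun x _ => dotv_ge0 _) I0.
set N := tuples _ in N0.
pose H := tuples [set x : 'rV[R]_n.+1 | x 0 0 = - (usubmx c 0 0 / dsubmx c 0 0)].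
have H0 : lebesgue_tuple R n.+1 H = 0%E by exact: lebesgue_tuple_hyperplane.
have mH : measurable H.
  have := @measurable_coord R n.+1 0 measurableT _ (measurable_set1 (- (usubmx c 0 0 / dsubmx c 0 0))).
  by rewrite setTI.
have mN : measurable N.
  have -> : N = tuples cell_interior `&`
    ((fun t => dotv (rtf c (row_of t)) (rtf c (row_of t))) @^-1` (~` [set 0])).
    by apply/seteqP; split => t [h1 /eqP h2]; split => //; apply/eqP.
  apply: measurableI; first exact: measurable_cell.
  rewrite -[X in measurable X]setTI; apply: tm.1 => //.
  exact: measurableC.
have [_] := fine_finite_volume measurable_cell vol0.
apply/negP; rewrite -leNgt.
apply: le_trans (_ : (lebesgue_tuple R n.+1 (N `|` H) <= 0)%E).
  apply: le_measure; rewrite ?inE.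
  - exact: measurable_cell.
  - exact: measurableU.
  - move=> t Dt; have [h|h] := eqVneq (rtf c (row_of t)) 0.
      by right; exact: rtf_eq0 h.
    by left; split => //; apply/eqP/eqP; rewrite dotv_eq0.
apply: le_trans (measureU2 _ mN mH) _.
by rewrite -[X in (X + _)%E]/(lebesgue_tuple R n.+1 N) N0 add0e -[X in (X <= _)%E]/(lebesgue_tuple R n.+1 H) H0.
Qed.

End Cell.

(** * Weak gradients *)

Lemma mulmx_tr_row (R : realType) m n (A : 'M[R]_(m, n)) (g : 'rV[R]_n) k :
  (A *m g^T) k 0 = dotv (row k A) g.
Proof. by rewrite mxE; apply: eq_bigr => l _; rewrite !mxE. Qed.

(** * Surface integrals over facets *)

Section Facets.
Variables (R : realType) (n : nat) (T : mesh R n).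

Definition unit_simplex : set 'rV[R]_n :=
  [set t : 'rV[R]_n | (forall k, 0 <= t 0 k) /\ \sum_k t 0 k <= 1].

Lemma measurable_unit_simplex : measurable (tuples unit_simplex).
Proof.
rewrite (_ : tuples _ =
  \bigcap_(k in [set: 'I_n]) ((fun t => row_of t 0 k) @^-1` `[0, +oo[) `&`
  ((fun t => \sum_k row_of t 0 k) @^-1` `]-oo, 1])).
  apply: measurableI.
    apply: fin_bigcap_measurable => // k _; rewrite -[X in measurable X]setTI.
    by apply: (measurable_coord k) => //; exact: measurable_itv.
  have [ms _] : tame set0 (fun t : 'rV[R]_n => \sum_k t 0 k).
    by apply: tame_sum => k; apply: tame_coord; exists 0.
  by rewrite -[X in measurable X]setTI; apply: ms => //; exact: measurable_itv.
apply/seteqP; split => [t [h1 h2]|t [h1 h2]]; split.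
- by move=> k _; rewrite /= in_itv /= andbT; exact: h1.
- by rewrite /= in_itv.
- by move=> k; have := h1 k I; rewrite /= in_itv /= andbT.
- by move: h2; rewrite /= in_itv.
Qed.

Lemma tame_simplex_coord k : tame unit_simplex (fun t => t 0 k).
Proof.
apply: tame_coord; exists 1 => t [t0 t1]; rewrite ger0_norm//.
by apply: le_trans t1; rewrite (bigD1 k)//= lerDl sumr_ge0.
Qed.

Variables (K : 'I_(n_elem T)) (i : 'I_n.+2).

Definition facet_edges : 'M[R]_(n, n.+1) :=
  \matrix_(k < n) (point (cell K (lift i (lift ord0 k))) - point (cell K (lift i ord0))).

Definition facet_param (t : 'rV[R]_n) : 'rV[R]_n.+1 :=
  point (cell K (lift i ord0)) + t *m facet_edges.

Lemma facet_intE f : facet_int K i f =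
  Num.sqrt (\det (facet_edges *m facet_edges^T)) *
  integral_on unit_simplex (fun t => f (facet_param t)).
Proof. by []. Qed.

Lemma tame_facet_dot (c : 'cV[R]_(n.+1 + 1)) v :
  tame unit_simplex (fun t => dotv (rtf c (facet_param t)) v).
Proof.
apply: tame_sum => k; apply: tameM; last exact: tame_cst.
have E : (fun t => rtf c (facet_param t) 0 k) = (fun t : 'rV[R]_n =>
  (usubmx c)^T 0 k + dsubmx c 0 0 *
  (point (cell K (lift i ord0)) 0 k + \sum_j t 0 j * facet_edges j k)).
  by apply/funext => t; rewrite /rtf /facet_param !mxE.
rewrite E; apply: tameD; first exact: tame_cst.
apply: tameM; first exact: tame_cst.
apply: tameD; first exact: tame_cst.
by apply: tame_sum => j; apply: tameM; [exact: tame_simplex_coord|exact: tame_cst].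
Qed.

Hypothesis Ku : vertex_mx K \in unitmx.

(** The [i]-th barycentric coordinate vanishes on the facet and is 1 at $x_i$ only; for [j = i] the
    value is the height of the simplex over the facet. *)
Lemma facet_param_normal (j : 'I_n.+2) t :
  dotv (facet_param t - point (cell K j)) (normal K i) =
  (j == i)%:R / enorm (grad_bary K i).
Proof.
have key : dotv (facet_param t - point (cell K j)) (grad_bary K i) = - (j == i)%:R.
  have -> : facet_param t - point (cell K j) =
      (point (cell K (lift i ord0)) - point (cell K j)) + t *m facet_edges.
    by rewrite /facet_param addrAC.
  rewrite dotvDl grad_bary_edge// eq_sym (negbTE (neq_lift _ _)) sub0r.
  rewrite mulmx_sum_row; have -> : forall s : 'rV[R]_n,
      dotv (\sum_k s 0 k *: row k facet_edges) (grad_bary K i) = 0; last by rewrite addr0.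
  move=> s; elim/big_rec : _ => [|k y _ IH]; first by rewrite dotv0l.
  rewrite dotvDl IH addr0 dotvZl rowK grad_bary_edge//.
  by rewrite ![lift _ _ == _]eq_sym !(negbTE (neq_lift _ _)) subrr mulr0.
rewrite /normal dotvC scaleNr dotvNl dotvZl dotvC key mulrN opprK.
by rewrite mulrC.
Qed.

(** Bordering the edges by the orthogonal vector [g] gives a square matrix whose squared determinant
    is $|g|^2$ times the Gram determinant, so the latter is nonnegative. It is nonzero because the
    edges are independent, being dual to the other barycentric gradients. *)
Lemma facet_gram_det_gt0 : 0 < \det (facet_edges *m facet_edges^T).
Proof.
pose g : 'rV[R]_n.+1 := grad_bary K i.
have gE k : dotv (row k facet_edges) g = 0.
  rewrite rowK grad_bary_edge//.
  by rewrite ![lift _ _ == _]eq_sym !(negbTE (neq_lift _ _)) subrr.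
have Eg : facet_edges *m g^T = 0.
  apply/matrixP => k j; rewrite (ord1 j) [RHS]mxE -[RHS](gE k).
  exact: mulmx_tr_row.
have gg : 0 < (g *m g^T) 0 0.
  rewrite mulmx_tr_row row_id.
  by rewrite lt_neqAle dotv_ge0 andbT eq_sym dotv_eq0 grad_bary_neq0.
pose C : 'M[R]_(1 + n) := col_mx g facet_edges.
have detC : \det C ^+ 2 = (g *m g^T) 0 0 * \det (facet_edges *m facet_edges^T).
  rewrite expr2 -{2}det_tr -det_mulmx /C tr_col_mx mul_col_row Eg.
  by rewrite -[g *m facet_edges^T]trmxK trmx_mul trmxK Eg trmx0 det_ublock det_mx11.
have spdE : spd (facet_edges *m facet_edges^T).
  split; first by rewrite trmx_mul trmxK.
  move=> u u0; rewrite lt_neqAle; apply/andP; split; last first.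
    by rewrite -[X in X *m _]trmxK; exact: psd_gram.
  apply/eqP => /esym q0; move/negP: u0; apply.
  have /(spd_eq0 (spd_1 _ _)) Eu0 : qform 1%:M (facet_edges^T *m u) <= 0.
    by rewrite qform_mul mulmx1 trmxK q0.
  apply/eqP/colP => k; rewrite [RHS]mxE.
  have : dotv (\sum_l u l 0 *: row l facet_edges)
      (grad_bary K (lift i (lift ord0 k))) = 0.
    rewrite -[X in dotv X _](_ : u^T *m facet_edges = _); last first.
      by rewrite mulmx_sum_row; apply: eq_bigr => l _; rewrite mxE.
    by rewrite -[u^T *m _]trmxK trmx_mul trmxK Eu0 trmx0 dotv0l.
  rewrite (bigD1 k)//= dotvDl dotvZl rowK grad_bary_edge// eqxx.
  rewrite (inj_eq lift_inj) (negbTE (neq_lift _ _)) subr0 mulr1.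
  rewrite [X in _ + X](_ : _ = 0) ?addr0//.
  elim/big_rec : _ => [|l y lk IH]; first by rewrite dotv0l.
  rewrite dotvDl IH addr0 dotvZl rowK grad_bary_edge//.
  by rewrite !(inj_eq lift_inj) (negbTE lk) (negbTE (neq_lift _ _)) subrr mulr0.
have d0 : \det (facet_edges *m facet_edges^T) != 0.
  by rewrite -unitfE -unitmxE spd_unitmx.
rewrite lt_neqAle eq_sym d0 /= -(pmulr_rge0 _ gg) -detC.
exact: sqr_ge0.
Qed.

Hypothesis hS : 0 < integral_on unit_simplex (cst 1).

Lemma facet_int_linear a v (c d : 'cV[R]_(n.+1 + 1)) b :
  facet_int K i (fun x => a * dotv (rtf (b *: c + d) x) v) =
  b * facet_int K i (fun x => a * dotv (rtf c x) v) + facet_int K i (fun x => a * dotv (rtf d x) v).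
Proof.
have [hF _] := fine_finite_volume measurable_unit_simplex hS.
have tm e : tame unit_simplex (fun t => a * dotv (rtf e (facet_param t)) v).
  by apply: tameM; [exact: tame_cst|exact: tame_facet_dot].
rewrite !facet_intE mulrCA -mulrDr; congr (_ * _).
rewrite -(integral_onZ hF)// -(integral_onD hF)//; last first.
  by apply: tameM => //; exact: tame_cst.
congr integral_on; apply/funext => t.
by rewrite rtf_linear dotvDl dotvZl; ring.
Qed.

Lemma facet_int_cst c : facet_int K i (fun=> c) = c * facet_int K i (cst 1).
Proof.
have [hF _] := fine_finite_volume measurable_unit_simplex hS.
rewrite !facet_intE mulrCA; congr (_ * _).
by rewrite !(integral_on_cst hF) mul1r.
Qed.

Lemma facet_int_cst1_gt0 : 0 < facet_int K i (cst 1).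
Proof. by rewrite facet_intE mulr_gt0// sqrtr_gt0 facet_gram_det_gt0. Qed.

End Facets.

(** * Weak gradients, the matrix $A_p$ and its Schur complement *)

Section WeakGradient.
Variables (R : realType) (n : nat) (T : mesh R n).
Hypothesis Tu : forall K, vertex_mx (T := T) K \in unitmx.
Hypothesis vol0 : forall K : 'I_(n_elem T), 0 < volume K.
Hypothesis hS : 0 < integral_on (@unit_simplex R n) (cst 1).

Definition wg_form (p : wfun T) K (d : 'cV[R]_(n.+1 + 1)) : R :=
  \sum_i facet_int K i (fun x => p.2 (facet K i) * dotv (rtf d x) (normal K i))
  - elem_int K (fun x => p.1 K * divergence (rtf d) x).

Lemma wg_form_linear p K a c d :
  wg_form p K (a *: c + d) = a * wg_form p K c + wg_form p K d.
Proof.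
have lin_sub (F G : 'cV[R]_(n.+1 + 1) -> R) :
    (forall b e f, F (b *: e + f) = b * F e + F f) ->
    (forall b e f, G (b *: e + f) = b * G e + G f) ->
    F (a *: c + d) - G (a *: c + d) = a * (F c - G c) + (F d - G d).
  by move=> -> ->; ring.
have lin_sum m (F : 'I_m -> 'cV[R]_(n.+1 + 1) -> R) :
    (forall i b e f, F i (b *: e + f) = b * F i e + F i f) ->
    forall b e f, \sum_i F i (b *: e + f) = b * (\sum_i F i e) + \sum_i F i f.
  by move=> hF b e f; rewrite mulr_sumr -big_split; apply: eq_bigr => i _; rewrite hF.
have lin_coord (G : 'cV[R]_(n.+1 + 1) -> R) v : (forall e, G e = v * dsubmx e 0 0) ->
    forall b e f, G (b *: e + f) = b * G e + G f.
  by move=> hG b e f; rewrite !hG !mxE; ring.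
refine (lin_sub
  (fun d => \sum_i facet_int K i (fun x => p.2 (facet K i) * dotv (rtf d x) (normal K i)))
  (fun d => elem_int K (fun x => p.1 K * divergence (rtf d) x)) _ _).
  refine (lin_sum _ (fun i d =>
    facet_int K i (fun x => p.2 (facet K i) * dotv (rtf d x) (normal K i))) _).
  by move=> i b e f; exact: facet_int_linear.
have [hF _] := fine_finite_volume (@measurable_cell _ _ _ K) (vol0 K).
apply: (lin_coord _ (p.1 K * n.+1%:R * fine (lebesgue_tuple R n.+1 (tuples (cell_interior K))))) => e.
transitivity (integral_on (cell_interior K) (fun=> p.1 K * (dsubmx e 0 0 * n.+1%:R))).
  by congr integral_on; apply/funext => x; rewrite divergence_rtf.
by rewrite (integral_on_cst hF); move: (fine _) => v; ring.
Qed.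

(** Solving with the Gram matrix (Riesz representation) yields a weak gradient, so the choice made
    by [xget] is a genuine one and not the default 0. *)
Lemma weak_gradient_rtf p K : exists c, weak_gradient p K = rtf c /\
  forall d, bform (rt_gram K) c d = wg_form p K d.
Proof.
have Hs := rt_gram_spd (Tu K) (vol0 K).
have : is_weak_gradient p K (weak_gradient p K).
  apply: (@xgetPex _ (cst 0) [set g | is_weak_gradient p K g]).
  pose l : 'cV[R]_(n.+1 + 1) := \col_i wg_form p K (delta_mx i 0).
  exists (rtf (invmx (rt_gram K) *m l)); split; first by apply/RT0P; eexists.
  move=> w /RT0P[d ->]; rewrite rt_gramE// -/(wg_form p K d).
  rewrite bform_mull trmx_inv (proj1 Hs) mulVmx ?spd_unitmx//.
  rewrite (linear_formE (wg_form_linear p K)) /bform mulmx1 mxE.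
  by apply: eq_bigr => i _; rewrite !mxE mulrC.
move=> [/RT0P[c ->] h]; exists c; split => // d.
by rewrite -rt_gramE// h//; apply/RT0P; exists d.
Qed.

Variable GpD : set 'rV[R]_n.+1.
Local Notation nf := (#|free_facets T GpD|).

(** The columns of [C K] are the $RT_0$ coefficients of the weak gradients of the basis functions;
    the second clause keeps their defining equation for later testing. *)
Lemma mx_ApE : exists C : 'I_(n_elem T) -> 'M[R]_(n.+1 + 1, n_elem T + nf),
  mx_Ap T GpD = \sum_K (C K)^T *m rt_gram K *m C K /\
  forall K k d, bform (rt_gram K) (col k (C K)) d = wg_form (wbasis k) K d.
Proof.
pose c K k := projT1 (cid (weak_gradient_rtf (@wbasis _ _ T GpD k) K)).
have cP K k : weak_gradient (@wbasis _ _ T GpD k) K = rtf (c K k) /\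
    forall d, bform (rt_gram K) (c K k) d = wg_form (@wbasis _ _ T GpD k) K d.
  by rewrite /c; case: cid.
pose C K : 'M[R]_(n.+1 + 1, n_elem T + nf) := \matrix_(i, k) c K k i 0.
have colC K k : col k (C K) = c K k by apply/colP => i; rewrite !mxE.
exists C; split; last by move=> K k d; rewrite colC (cP K k).2.
apply/matrixP => k l; rewrite summxE mxE; apply: eq_bigr => K _.
rewrite (cP K k).1 (cP K l).1 rt_gramE//.
have Hs := (rt_gram_spd (Tu K) (vol0 K)).1.
by rewrite -{1}Hs bform_trmx -!colC !colE bform_mulr bform_mull bform_delta mulmxA.
Qed.

Lemma mx_Ap_tr : (mx_Ap T GpD)^T = mx_Ap T GpD.
Proof.
apply/matrixP => k l; rewrite mxE [LHS]mxE [RHS]mxE; apply: eq_bigr => K _.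
by apply: (congr1 (elem_int K)); apply/funext => x; exact: dotvC.
Qed.

Lemma qform_sum (I : finType) m (F : I -> 'M[R]_m) u :
  qform (\sum_i F i) u = \sum_i qform (F i) u.
Proof. by rewrite /qform mulmx_sumr mulmx_suml summxE. Qed.

Lemma mx_Ap_psd : psd (mx_Ap T GpD).
Proof.
have [C [-> _]] := mx_ApE => u; rewrite qform_sum sumr_ge0// => K _.
by rewrite -qform_mul spd_psd//; exact: rt_gram_spd.
Qed.

Let facet_vec (i : 'I_n.+2) (K : 'I_(n_elem T)) : 'cV[R]_(n.+1 + 1) :=
  col_mx (- point (cell K i))^T 1%:M.

(* The Raviart-Thomas field x - x_i has vanishing normal component on all facets
   but the one opposite to x_i. *)
Let wg_form_facet_vec f K i :
  wg_form (@wbasis _ _ T GpD (rshift _ f)) K (facet_vec i K) =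
  (facet K i == enum_val f)%:R * ((enorm (grad_bary K i))^-1 * facet_int K i (cst 1)).
Proof.
have E x : rtf (facet_vec i K) x = x - point (cell K i).
  by rewrite /rtf col_mxKu col_mxKd trmxK mxE mulr1n scale1r addrC.
rewrite /wg_form /wbasis (unsplitK (inr f)) /= [X in _ - X](_ : _ = 0) ?subr0; last first.
  have [hF _] := fine_finite_volume (@measurable_cell _ _ _ K) (vol0 K).
  rewrite -[RHS](mul0r (fine (lebesgue_tuple R n.+1 (tuples (cell_interior K))))).
  by rewrite -(integral_on_cst hF); congr integral_on; apply/funext => x; rewrite mul0r.
have F j : facet_int K j (fun x => (facet K j == enum_val f)%:R *
    dotv (rtf (facet_vec i K) x) (normal K j)) =
    (facet K j == enum_val f)%:R * ((i == j)%:R / enorm (grad_bary K j)) * facet_int K j (cst 1).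
  rewrite -facet_int_cst// !facet_intE; congr (_ * _); congr integral_on.
  by apply/funext => t; rewrite E facet_param_normal.
rewrite (bigD1 i)//= F eqxx mul1r big1 ?addr0 ?mulrA// => j ji.
by rewrite F [i == j]eq_sym (negbTE ji) mul0r mulr0 mul0r.
Qed.

(** Zero energy makes every elementwise weak gradient vanish. Testing with $x - x_i$ on a cell whose
    [i]-th facet is [f] leaves [v f 0] times a positive factor. *)
Lemma mx_Ap_facet_spd : spd (drsubmx (mx_Ap T GpD)).
Proof.
split; first by rewrite trmx_drsub mx_Ap_tr.
move=> v v0.
have qE : qform (drsubmx (mx_Ap T GpD)) v = qform (mx_Ap T GpD) (col_mx 0 v).
  rewrite -[mx_Ap T GpD in RHS]submxK /qform tr_col_mx trmx0 mul_row_block !mul0mx !add0r.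
  by rewrite mul_row_col mulmx0 add0r.
rewrite lt_neqAle qE mx_Ap_psd andbT; apply/eqP => /esym q0.
move/negP: v0; apply; apply/eqP/colP => f; rewrite [RHS]mxE.
have [C [AE CE]] := mx_ApE.
have C0 K : C K *m col_mx 0 v = 0.
  apply: (spd_eq0 (rt_gram_spd (Tu K) (vol0 K))).
  move: q0; rewrite AE qform_sum => /eqP.
  rewrite psumr_eq0 => [/allP h|K' _]; last first.
    by rewrite -qform_mul spd_psd//; exact: rt_gram_spd.
  have := h K; rewrite mem_index_enum => /(_ isT) /=.
  by rewrite qform_mul => /eqP ->.
have : enum_val f \in free_facets T GpD by exact: enum_valP.
rewrite inE => /andP[/imsetP[[K i] _ /= fE] _].
have := congr1 (fun c => bform (rt_gram K) c (facet_vec i K)) (C0 K).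
have -> : C K *m col_mx 0 v = \sum_f' v f' 0 *: col (rshift _ f') (C K).
  rewrite [LHS](_ : _ = \sum_k (col_mx 0 v) k 0 *: col k (C K)).
    rewrite big_split_ord /= [X in X + _]big1 ?add0r => [|k _]; last first.
      by rewrite col_mxEu mxE scale0r.
    by apply: eq_bigr => f' _; rewrite col_mxEd.
  apply/colP => a; rewrite mxE summxE; apply: eq_bigr => k _.
  by rewrite !mxE mulrC.
have -> : bform (rt_gram K) (\sum_f' v f' 0 *: col (rshift _ f') (C K)) (facet_vec i K) =
   \sum_f' v f' 0 * bform (rt_gram K) (col (rshift _ f') (C K)) (facet_vec i K).
  elim/big_rec2 : _ => [|f' a b _ <-]; last by rewrite bformDl bformZl.
  by rewrite /bform trmx0 !mul0mx mxE.
rewrite /= [bform _ 0 _](_ : _ = 0); last by rewrite /bform trmx0 !mul0mx mxE.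
rewrite (bigD1 f)//= CE wg_form_facet_vec -fE eqxx mul1r big1 => [|f' ff']; last first.
  rewrite CE wg_form_facet_vec -fE (inj_eq enum_val_inj) eq_sym (negbTE ff').
  by rewrite mul0r mulr0.
rewrite addr0 => /eqP; rewrite mulf_eq0 => /orP[/eqP//|].
rewrite mulf_eq0 invr_eq0 gt_eqF ?enorm_row_gt0 ?grad_bary_neq0//=.
by rewrite gt_eqF// facet_int_cst1_gt0.
Qed.

(** The Schur complement at [u] is the full form at the vector whose second part annihilates the
    lower block row. *)
Lemma schur_psd p q (A : 'M[R]_(p + q)) : psd A -> drsubmx A \in unitmx ->
  psd (ulsubmx A - ursubmx A *m invmx (drsubmx A) *m dlsubmx A).
Proof.
move=> A0 Xu u; have := A0 (col_mx u (- (invmx (drsubmx A) *m (dlsubmx A *m u)))).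
rewrite -[A in qform A _]submxK /qform -mulmxA mul_block_col !mulmxN mulKVmx// subrr.
rewrite tr_col_mx mul_row_col mulmx0 addr0.
by rewrite -[_ *m u in X in _ -> X]mulmxA mulmxBl !mulmxA.
Qed.

Lemma mx_Dt_psd (c0 k dt : R) : 0 <= c0 -> 0 <= k * dt -> psd (mx_Mp T) ->
  psd (mx_Dt T GpD c0 k dt).
Proof.
move=> c00 k0 M0 u; rewrite /mx_Dt qformE bform_addm !bform_scalem.
apply: addr_ge0; first by rewrite mulr_ge0// M0.
rewrite mulr_ge0//; apply: schur_psd; first exact: mx_Ap_psd.
by apply: spd_unitmx; exact: mx_Ap_facet_spd.
Qed.

End WeakGradient.

(** * Preconditioning and the limit of small eps *)

Section Preconditioning.
Variable R : realType.

(** With $w = Sv$ this is $b|v| \le |\hat A v| \le a|v|$ for the preconditioned matrix $\hat A =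
    SAS$, stated without [S]. *)
Definition spectral_bounds n (A P : 'M[R]_n) (b a : R) : Prop :=
  forall w : 'cV[R]_n, b ^+ 2 * qform P w <= qform (invmx P) (A *m w) /\
    qform (invmx P) (A *m w) <= a ^+ 2 * qform P w.

Lemma enorm_gt0 n (v : 'cV[R]_n) : v != 0 -> 0 < enorm v.
Proof. by move=> v0; rewrite enormE sqrtr_gt0; exact: (spd_1 R n).2. Qed.

Lemma inv_sqrt_invmx n (P S : 'M[R]_n) : inv_sqrt_mx P S -> invmx P = S *m S.
Proof. by move=> [_ h]; apply: invmx_uniq. Qed.

Lemma inv_sqrt_spd n (P S : 'M[R]_n) : inv_sqrt_mx P S -> spd P.
Proof.
move=> [Ss h]; have Su := spd_unitmx Ss; have St := Ss.1.
have <- : invmx (S *m S) = P by apply: invmx_uniq; exact: mulmx1C.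
apply: spd_invmx; split; first by rewrite trmx_mul St.
move=> u u0; have -> : S *m S = S^T *m 1%:M *m S by rewrite mulmx1 St.
rewrite -qform_mul; apply: (spd_1 R n).2; apply: contra u0 => /eqP Su0.
by rewrite -[u](mulKmx Su) Su0 mulmx0.
Qed.

Lemma inv_sqrt_qform n (P S : 'M[R]_n) v : inv_sqrt_mx P S ->
  qform P (S *m v) = qform 1%:M v.
Proof.
move=> [Ss h]; rewrite qform_mul Ss.1; congr qform.
by apply: mulmx1C; rewrite mulmxA.
Qed.

Lemma inv_sqrt_qform_inv n (P S A : 'M[R]_n) v : inv_sqrt_mx P S ->
  qform (invmx P) (A *m (S *m v)) = qform 1%:M (S *m A *m S *m v).
Proof.
move=> hS; rewrite (inv_sqrt_invmx hS) -!mulmxA [RHS]qform_mul mulmx1.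
by rewrite hS.1.1.
Qed.

Lemma qform1_mulmx_bound m n (A : 'M[R]_(m, n)) : exists2 c, 0 < c &
  forall v, qform 1%:M (A *m v) <= c * qform 1%:M v.
Proof.
exists (1 + \sum_i (\sum_j `|A i j|) ^+ 2).
  by rewrite ltr_pwDl// sumr_ge0// => i _; exact: sqr_ge0.
move=> v; rewrite mulrDl mul1r; apply: ler_wpDl; first exact: (spd_psd (spd_1 R n)).
rewrite {1}qform1 mulr_suml; apply: ler_sum => i _; rewrite mxE.
have v2 j : `|v j 0| <= Num.sqrt (qform 1%:M v).
  rewrite -sqrtr_sqr ler_sqrt ?qform1; last by rewrite sumr_ge0// => k _; exact: sqr_ge0.
  by rewrite (bigD1 j)//= lerDl sumr_ge0// => k _; exact: sqr_ge0.
rewrite -[X in _ * X](sqr_sqrtr (spd_psd (spd_1 R n) v)) -exprMn -[leLHS]real_normK ?num_real//.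
rewrite lerXn2r ?nnegrE ?mulr_ge0 ?sumr_ge0 ?sqrtr_ge0//.
rewrite mulr_suml; apply: le_trans (ler_norm_sum _ _ _) _; apply: ler_sum => j _.
by rewrite normrM ler_wpM2l.
Qed.

(** The bounds come from the norms of the preconditioned matrix and of its inverse; they may depend
    on every parameter. *)
Lemma spectral_bounds_exist n (A P S : 'M[R]_n) : inv_sqrt_mx P S -> A \in unitmx ->
  exists b a, [/\ 0 < b, b < a & spectral_bounds A P b a].
Proof.
move=> hS Au; have Su := spd_unitmx hS.1.
pose H := S *m A *m S.
have Hu : H \in unitmx by rewrite !unitmx_mul Su Au.
have [c c0 hc] := qform1_mulmx_bound H.
have [d d0 hd] := qform1_mulmx_bound (invmx H).
(* The extra summand in the upper bound makes the inequality between the bounds strict. *)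
exists (Num.sqrt d^-1), (Num.sqrt c + Num.sqrt d^-1); split.
- by rewrite sqrtr_gt0 invr_gt0.
- by rewrite ltrDr sqrtr_gt0.
move=> w; rewrite -[w](mulKVmx Su); set v := invmx S *m w.
rewrite (inv_sqrt_qform _ hS) (inv_sqrt_qform_inv _ _ hS) -/H; split.
  rewrite sqr_sqrtr ?invr_ge0 ?(ltW d0)// mulrC ler_pdivrMr// mulrC.
  by rewrite -{1}[v](mulKmx Hu) hd.
apply: le_trans (hc v) _; rewrite ler_wpM2r//; first exact: (spd_psd (spd_1 R n)).
rewrite -[leLHS](sqr_sqrtr (ltW c0)) lerXn2r ?nnegrE ?addr_ge0 ?sqrtr_ge0//.
by rewrite lerDl sqrtr_ge0.
Qed.

Lemma preconditioned_minres_bound n (A P S : 'M[R]_n) a b rhs x0 x k :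
  A^T = A -> inv_sqrt_mx P S -> 0 < b -> b < a -> spectral_bounds A P b a ->
  let Ahat := S *m A *m S in
  minres_iterate Ahat rhs x0 (2 * k) x -> rhs - Ahat *m x0 != 0 ->
  enorm (rhs - Ahat *m x) / enorm (rhs - Ahat *m x0) <=
  2 * ((Num.sqrt (a * a / (b * b)) - 1) / (Num.sqrt (a * a / (b * b)) + 1)) ^+ k.
Proof.
move=> At hS b0 ba h Ahat hx r0.
have -> : Num.sqrt (a * a / (b * b)) = a / b.
  rewrite -!expr2 -expr_div_n sqrtr_sqr ger0_norm// divr_ge0 ?ltW//.
  exact: lt_trans ba.
rewrite ler_pdivrMr ?enorm_gt0//.
apply: minres_bound => //.
- by rewrite /Ahat !trmx_mul At hS.1.1 mulmxA.
- by move=> v; rewrite -(inv_sqrt_qform_inv _ _ hS) -(inv_sqrt_qform _ hS) (h _).1.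
- by move=> v; rewrite -(inv_sqrt_qform_inv _ _ hS) -(inv_sqrt_qform _ hS) (h _).2.
Qed.

End Preconditioning.

Section Limits.
Variable R : realType.

(** For $t \ge 0$, the nonnegative root of $s(1+s) = t$; then [qroot t + 1] solves $d(d-1) = t$. *)
Definition qroot (t : R) : R := 2^-1 * (Num.sqrt (4 * t + 1) - 1).

Lemma qrootP t : 0 <= t -> qroot t * (1 + qroot t) = t.
Proof.
move=> t0; have h : Num.sqrt (4 * t + 1) ^+ 2 = 4 * t + 1 by rewrite sqr_sqrtr//; lra.
have -> : qroot t * (1 + qroot t) = (Num.sqrt (4 * t + 1) ^+ 2 - 1) / 4.
  by rewrite /qroot; field.
by rewrite h; field.
Qed.

Lemma qroot0 : qroot 0 = 0.
Proof. by rewrite /qroot mulr0 add0r sqrtr1 subrr mulr0. Qed.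

Lemma ltr_qroot s t : 0 <= s -> s < t -> qroot s < qroot t.
Proof.
move=> s0 st; rewrite /qroot ltr_pM2l ?invr_gt0// ltrD2r ltr_sqrt; lra.
Qed.

Lemma qroot_gt0 t : 0 < t -> 0 < qroot t.
Proof. by move=> t0; rewrite -qroot0 ltr_qroot. Qed.

(** [t] is chosen so that Young's inequality consumes half of the gap $s^2 - b^2$, and [e] so that
    the [eps] term consumes at most the other half. The upper bound below divides its gap
    likewise. *)
Lemma perturbed_lo (b s : R) : 0 < b -> b < s -> exists t e : R,
  [/\ 0 < t, t <= 1, 0 < e & forall x, x < e -> b ^+ 2 <= (1 - t) * s ^+ 2 - 3 * x / t].
Proof.
move=> b0 bs; have s0 : 0 < s by apply: lt_trans bs.
have s2 : 0 < s ^+ 2 by rewrite exprn_gt0.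
have b2 : 0 < b ^+ 2 by rewrite exprn_gt0.
have bs2 : b ^+ 2 < s ^+ 2 by rewrite ltrXn2r// ltW.
pose t := (s ^+ 2 - b ^+ 2) / (2 * s ^+ 2).
have t0 : 0 < t by rewrite divr_gt0 ?subr_gt0 ?mulr_gt0.
have ts : t * s ^+ 2 = (s ^+ 2 - b ^+ 2) / 2 by rewrite /t; field; rewrite gt_eqF.
exists t, (t * (s ^+ 2 - b ^+ 2) / 6); split => //.
- rewrite ler_pdivrMr ?mulr_gt0//; lra.
- by rewrite divr_gt0// mulr_gt0// subr_gt0.
move=> x hx; rewrite mulrBl ts mul1r.
have : 3 * x / t <= (s ^+ 2 - b ^+ 2) / 2 by rewrite ler_pdivrMr//; lra.
by lra.
Qed.

Lemma perturbed_hi (d a : R) : 0 < d -> d < a -> exists t e : R,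
  [/\ 0 < t, 0 < e & forall x, x < e -> (1 + t) * d ^+ 2 + 3 * x * (1 + t^-1) <= a ^+ 2].
Proof.
move=> d0 da; have d2 : 0 < d ^+ 2 by rewrite exprn_gt0.
have da2 : d ^+ 2 < a ^+ 2 by rewrite ltrXn2r// ltW.
pose t := (a ^+ 2 - d ^+ 2) / (2 * d ^+ 2).
have t0 : 0 < t by rewrite divr_gt0 ?subr_gt0 ?mulr_gt0.
have ts : t * d ^+ 2 = (a ^+ 2 - d ^+ 2) / 2 by rewrite /t; field; rewrite gt_eqF.
have u0 : 0 < 1 + t^-1 by rewrite addr_gt0 ?invr_gt0.
exists t, ((a ^+ 2 - d ^+ 2) / (6 * (1 + t^-1))); split => //.
  by rewrite divr_gt0 ?subr_gt0// mulr_gt0.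
move=> x; rewrite ltr_pdivlMr ?mulr_gt0// => hx; rewrite mulrDl ts mul1r.
by lra.
Qed.

End Limits.

Section SaddlePoint.
Variables (R : realType) (m N : nat).
Variables (A1 : 'M[R]_m) (M : 'M[R]_N) (B : 'M[R]_(N, m)).

Lemma sadA_tr (E : 'M[R]_N) eps : A1^T = A1 -> E^T = E -> M^T = M ->
  (sadA A1 E M B eps)^T = sadA A1 E M B eps.
Proof.
move=> At Et Mt; rewrite /sadA !tr_block_mx tr_row_mx tr_col_mx !linearN /= !linearZ /=.
by rewrite At Et Mt !trmx0 trmxK.
Qed.

End SaddlePoint.

(* The limits have strict slack: the extreme eigenvalue moduli at eps = 0 are
   bounded by qroot C + 1 and qroot (beta ^+ 2), so that a perturbation bound
   without rate suffices. *)
Lemma saddle_limit_bounds (R : realType) (beta C : R) :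
  0 < beta -> beta < 1 -> 0 < C ->
  exists2 e0 : R, 0 < e0 & forall m N (A1 : 'M[R]_m) (E M : 'M[R]_N) (B : 'M[R]_(N, m)) eps,
    0 < eps -> eps < e0 -> spd A1 -> spd E -> spd M ->
    (forall y, eps * qform M y <= qform E y) ->
    (forall p : 'cV[R]_N, beta ^+ 2 * qform M p <= qform (invmx A1) (B^T *m p)) ->
    (forall u : 'cV[R]_m, qform (invmx M) (B *m u) <= C * qform A1 u) ->
    spectral_bounds (sadA A1 E M B eps) (sadP A1 E M)
      (qroot (beta ^+ 2 / (1 + beta ^+ 2))) (qroot (1 + C) + 1).
Proof.
move=> b0 b1 C0.
have bb0 : 0 < beta ^+ 2 by rewrite exprn_gt0.
have bb1 : beta ^+ 2 < 1 by rewrite expr_lt1// ltW.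
have g0 : 0 < beta ^+ 2 / (1 + beta ^+ 2) by rewrite divr_gt0// addr_gt0.
have gb : beta ^+ 2 / (1 + beta ^+ 2) < beta ^+ 2.
  by rewrite ltr_pdivrMr ?addr_gt0// ltr_pMr// ltrDl.
have s0 := qroot_gt0 bb0; have sE := qrootP (ltW bb0).
set s := qroot (beta ^+ 2) in s0 sE.
have s1 : s <= 1.
  rewrite leNgt; apply/negP => s1.
  have : 1 < s * (1 + s) by rewrite -[ltLHS]mulr1 ltr_pM// ltrDl.
  by lra.
have d0 := qroot_gt0 C0; have dE := qrootP (ltW C0).
set d := qroot C in d0 dE.
have [|t [e1 [t0 t1 e10 h1]]] := perturbed_lo (qroot_gt0 g0) (_ : _ < s).
  by apply: ltr_qroot => //; exact: ltW.
have [||t' [e2 [t'0 e20 h2]]] := @perturbed_hi R (d + 1) (qroot (1 + C) + 1).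
- by rewrite addr_gt0.
- by rewrite ltrD2r ltr_qroot ?ltrDr// ltW.
exists (Num.min 1 (Num.min e1 e2)); first by rewrite !lt_min ltr01 e10 e20.
move=> m N A1 E M B eps eps0; rewrite !lt_min => /andP[x1 /andP[x2 x3]] A1s Es Ms hE hinf hkorn w.
have Ps : 0 <= qform (sadP A1 E M) w.
  rewrite -[w]vsubmxK -[dsubmx w]vsubmxK sadP_qform.
  by rewrite !addr_ge0//; exact: spd_psd.
split.
  apply: le_trans (ler_wpM2r Ps (h1 _ x2)) _.
  by apply: (saddle_lo A1s Es Ms eps0 hE hinf w s0 s1) => //; rewrite ?sE// ltW.
apply: le_trans (ler_wpM2r Ps (h2 _ x3)).
apply: (saddle_hi A1s Es Ms eps0 hE hkorn w) => //.
- by rewrite ltrDr.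
- by rewrite addrK mulrC addrC dE.
- exact: ltW.
Qed.

Lemma bform_cauchy_schwarz (R : realType) n (A : 'M[R]_n) u v : spd A ->
  bform A u v ^+ 2 <= qform A u * qform A v.
Proof.
move=> As; have [->|v0] := eqVneq v 0.
  by rewrite /bform mulmx0 mxE expr0n qform0 mulr0.
have q0 := As.2 _ v0; rewrite -(ler_pM2l q0).
have := spd_psd As (qform A v *: u - bform A u v *: v).
rewrite (qformD _ _ As.1) qformN !qformZ bformNr bformZl bformZr.
by lra.
Qed.

Section Assembly.
Variables (R : realType) (n : nat) (T : mesh R n) (m : nat).
Variable phi : 'I_m -> 'rV[R]_n.+1 -> 'rV[R]_n.+1.

(** By Cauchy-Schwarz in the $A_1$ inner product, the supremum is at most the $A_1$ norm of
    $A_1^{-1}B^Tp$. *)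
Lemma inf_sup_qform (beta : R) : 0 < beta -> spd (mx_A1 T phi) -> spd (mx_Mp T) -> inf_sup T beta phi ->
  forall p, beta ^+ 2 * qform (mx_Mp T) p <=
    qform (invmx (mx_A1 T phi)) ((mx_B T phi)^T *m p).
Proof.
move=> b0 As Ms h p; set z := invmx (mx_A1 T phi) *m ((mx_B T phi)^T *m p).
have Az : mx_A1 T phi *m z = (mx_B T phi)^T *m p by rewrite mulKVmx ?spd_unitmx.
rewrite -Az qform_invmx//.
have zq := spd_psd As z.
have : (beta * Num.sqrt (qform (mx_Mp T) p) <= Num.sqrt (qform (mx_A1 T phi) z))%R.
  rewrite -lee_fin; apply: le_trans (h p) _; apply: ge_ereal_sup => _ [v v0 <-].
  have q0 := As.2 _ v0.
  rewrite lee_fin ler_pdivrMr ?sqrtr_gt0// -sqrtrM//.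
  apply: le_trans (ler_norm _) _; rewrite -sqrtr_sqr ler_sqrt ?mulr_ge0 ?(ltW q0)//.
  apply: le_trans (bform_cauchy_schwarz z v As); rewrite le_eqVlt; apply/orP; left; apply/eqP.
  congr (_ ^+ 2); rewrite -[RHS]bform_trmx As.1.
  have -> : bform (mx_A1 T phi) v z = bform 1%:M v (mx_A1 T phi *m z).
    by rewrite bform_mulr mul1mx.
  by rewrite Az bform_mulr mul1mx bform_trmx.
rewrite -(ler_pXn2r (ltn0Sn 1)) ?nnegrE ?mulr_ge0 ?sqrtr_ge0 ?(ltW b0)//.
by rewrite exprMn !sqr_sqrtr// spd_psd.
Qed.

Lemma korn_qform (C : R) : korn_bound T C phi ->
  forall u, qform (invmx (mx_Mp T)) (mx_B T phi *m u) <= C * qform (mx_A1 T phi) u.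
Proof. by move=> h u; rewrite qform_mul; exact: h. Qed.

Lemma volume_gt0 : spd (mx_Mp T) -> forall K : 'I_(n_elem T), 0 < volume K.
Proof.
move=> [_ h] K; have := h (delta_mx K 0).
rewrite qformE bform_delta !mxE eqxx mulr1n; apply.
apply/eqP => /matrixP/(_ K 0); rewrite !mxE !eqxx => /eqP.
by rewrite oner_eq0.
Qed.

(** Every facet integral carries the integral over the reference simplex, so a positive surface
    measure forces the latter to be positive without computing it. *)
Lemma unit_simplex_volume_gt0 G : 0 < surface_measure T G ->
  0 < integral_on (@unit_simplex R n) (cst 1).
Proof.
move=> h; rewrite lt_neqAle integral_on_ge0 ?andbT; last by move=> *; exact: ler01.
apply/eqP => /esym e; move: h; rewrite /surface_measure big1 ?ltxx// => K _.
by rewrite big1// => i _; rewrite facet_intE e mulr0.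
Qed.

Lemma mx_A3E GpD (mu alpha c0 kappa dt eps : R) :
  mx_A3 T GpD mu alpha c0 kappa dt eps phi =
  sadA (mx_A1 T phi) ((2 * mu / alpha ^+ 2) *: mx_Dt T GpD c0 kappa dt + eps *: mx_Mp T)
    (mx_Mp T) (mx_B T phi) eps.
Proof. by rewrite /mx_A3 /sadA opprD. Qed.

End Assembly.

Theorem proposition4p1 (R : realType) (n : nat)
    (Omega GuD GuN GpD GpN : set 'rV[R]_n.+1)
    (hOmega : lipschitz_domain Omega)
    (mu alpha c0 kappa dt : R)
    (hmu : 0 < mu) (halpha : 0 < alpha) (hc0 : 0 < c0)
    (hkappa : 0 < kappa) (hdt : 0 < dt)
    (s beta CKorn : R) (hbeta0 : 0 < beta) (hbeta1 : beta < 1) :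
  let a_lim := 2^-1 * (Num.sqrt (4 * (1 + CKorn) + 1) + 1) in
  let b_lim :=
    2^-1 * (Num.sqrt (4 * (beta ^+ 2 / (1 + beta ^+ 2)) + 1) - 1) in
  exists C eps0 : R, [/\ 0 < C, 0 < eps0 &
    forall (T : mesh R n) (m : nat) (phi : 'I_m -> 'rV[R]_n.+1 -> 'rV[R]_n.+1),
      simplicial_mesh T Omega ->
      connected_mesh T ->
      quasi_uniform T s ->
      boundary_partition T Omega GuD GuN ->
      boundary_partition T Omega GpD GpN ->
      0 < surface_measure T GuN ->
      0 < surface_measure T GuD ->
      basis_of_space (Vh0 T Omega GuD) phi ->
      inf_sup T beta phi ->
      korn_bound T CKorn phi ->
    forall lambda : R, 0 < lambda ->
    let eps := 2 * mu / lambda in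
    let A := mx_A3 T GpD mu alpha c0 kappa dt eps phi in
    let P := mx_Pd T GpD mu alpha c0 kappa dt eps phi in
    exists a2 b2 c2 d2 : R,
      [/\ [/\ 0 < a2, 0 < b2, 0 < c2 & 0 < d2],
          eps < eps0 ->
            [/\ `|a2 - a_lim| <= C * eps, `|d2 - a_lim| <= C * eps,
                `|b2 - b_lim| <= C * eps & `|c2 - b_lim| <= C * eps] &
          forall S : 'M[R]_(m + (n_elem T + n_elem T)), inv_sqrt_mx P S ->
          forall (rhs : 'cV[R]_(m + (n_elem T + n_elem T)))
                 (x : nat -> 'cV[R]_(m + (n_elem T + n_elem T))),
            let Ahat := S *m A *m S in
            let r j := rhs - Ahat *m x j in
            (forall j, minres_iterate Ahat rhs (x 0%N) j (x j)) ->
            r 0%N != 0 ->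
            let q := Num.sqrt ((a2 * d2) / (b2 * c2)) in
            forall k : nat,
              enorm (r (2 * k)%N) / enorm (r 0%N) <=
              2 * ((q - 1) / (q + 1)) ^+ k]].
Proof.
move=> a_lim b_lim.
have aE : a_lim = qroot (1 + CKorn) + 1 by rewrite /qroot /a_lim; field.
(* The threshold is fixed before any mesh is given, while [0 < CKorn] follows only from a mesh;
   hence the implication, and an arbitrary threshold when it is void. *)
have [e0 e00 he0] : exists2 e0 : R, 0 < e0 & 0 < CKorn ->
    forall m N (A1 : 'M[R]_m) (E M : 'M[R]_N) (B : 'M[R]_(N, m)) eps,
    0 < eps -> eps < e0 -> spd A1 -> spd E -> spd M ->
    (forall y, eps * qform M y <= qform E y) ->
    (forall p : 'cV[R]_N, beta ^+ 2 * qform M p <= qform (invmx A1) (B^T *m p)) ->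
    (forall u : 'cV[R]_m, qform (invmx M) (B *m u) <= CKorn * qform A1 u) ->
    spectral_bounds (sadA A1 E M B eps) (sadP A1 E M) b_lim a_lim.
  have [C0|C0] := ltP 0 CKorn; last by exists 1 => // /lt_geF; rewrite C0.
  have [e0 e00 h] := saddle_limit_bounds hbeta0 hbeta1 C0.
  by exists e0 => // _; rewrite aE.
have b2 : 0 < beta ^+ 2 by rewrite exprn_gt0.
have g0 : 0 < beta ^+ 2 / (1 + beta ^+ 2) by rewrite divr_gt0// addr_gt0.
have b_lim0 : 0 < b_lim by exact: qroot_gt0.
have a_lim0 : 0 < a_lim.
  by rewrite mulr_gt0 ?invr_gt0// ltr_wpDl ?sqrtr_ge0.
(* Below the threshold the four numbers equal their limits, so any positive constant serves in
   $O(\epsilon)$. *)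
exists 1, e0; split => // T m phi hT _ _ _ _ _ hGuD _ hinf hkorn lambda lambda0 eps A P.
have eps0 : 0 < eps by rewrite divr_gt0// mulr_gt0.
have norm0 (r : R) : `|r - r| <= 1 * eps by rewrite subrr normr0 mul1r ltW.
(* Without an inverse square root of [P] the residual claim is vacuous. With one, [P] and its
   diagonal blocks are positive definite, which supplies the positivity of [mx_A1] and of the
   volumes. *)
have [[S0 hS0]|noS] := pselect (exists S, inv_sqrt_mx P S); last first.
  exists a_lim, b_lim, b_lim, a_lim; split => // S hS.
  by exfalso; apply: noS; exists S.
have Ps := inv_sqrt_spd hS0.
set c := 2 * mu / alpha ^+ 2; set D := mx_Dt T GpD c0 kappa dt.
have [A1s /spd_diag[Es Ms]] : spd (mx_A1 T phi) /\
    spd (block_mx (c *: D + eps *: mx_Mp T) 0 0 (mx_Mp T)) by exact: spd_diag.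
have c_gt0 : 0 < c by rewrite divr_gt0 ?mulr_gt0 ?exprn_gt0.
have hE y : eps * qform (mx_Mp T) y <= qform (c *: D + eps *: mx_Mp T) y.
  rewrite !qformE bform_addm !bform_scalem lerDr mulr_ge0 ?(ltW c_gt0)//.
  apply: mx_Dt_psd.
  - by case: hT.
  - exact: volume_gt0.
  - exact: unit_simplex_volume_gt0 hGuD.
  - exact: ltW.
  - by rewrite mulr_ge0 ?ltW.
  - exact: spd_psd.
have hinf' := inf_sup_qform hbeta0 A1s Ms hinf.
have hkorn' := korn_qform hkorn.
have CK0 : 0 < CKorn.
  (* The constant pressure is nonzero because the mesh has an element. *)
  apply: (korn_gt0 A1s Ms hbeta0 hinf' hkorn' (p := const_mx 1)).
  apply/eqP => /matrixP; case: hT => N0 _ _ _ _ => /(_ (Ordinal N0) 0); rewrite !mxE.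
  by move/eqP; rewrite oner_eq0.
have At : A^T = A.
  by rewrite /A mx_A3E; apply: sadA_tr; [exact: A1s.1|exact: Es.1|exact: Ms.1].
have Au : A \in unitmx by rewrite /A mx_A3E; exact: (sadA_unitmx A1s Es Ms eps0 hE hbeta0 hinf').
(* For small [eps] the limits themselves are spectral bounds; for the others nonsingularity provides
   some bounds, and no closeness is claimed. *)
have [b [a [b0 ba hab hlim]]] : exists b a, [/\ 0 < b, b < a, spectral_bounds A P b a &
    eps < e0 -> a = a_lim /\ b = b_lim].
  have [epse|epse] := ltP eps e0.
    exists b_lim, a_lim; split => //; last by rewrite /A mx_A3E; exact: he0.
    rewrite aE; apply: lt_trans (_ : qroot (1 + CKorn) < _); last by rewrite ltrDl.
    apply: ltr_qroot; first exact: ltW.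
    by apply: (@lt_trans _ _ 1); [rewrite ltr_pdivrMr ?addr_gt0// mul1r ltrDr|rewrite ltrDl].
  have [b [a [b0 ba h]]] := spectral_bounds_exist hS0 Au.
  by exists b, a; split.
have a0 : 0 < a by apply: lt_trans ba.
exists a, b, b, a; split => //.
  by move=> /hlim[-> ->].
move=> S hS rhs x Ahat r hx r0 q k.
exact: (preconditioned_minres_bound At hS b0 ba hab (hx (2 * k)%N) r0).
Qed.
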